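(* Let $A$ be a finite-dimensional commutative differential graded algebra and let $V$ be a finite-dimensional $L_\infty$ algebra. Equip $A\otimes V$ with the tensor product $L_\infty$ structure. Then: (1) The $L_\infty$ algebra $A\otimes V$ is strictly unimodular if and only if either $V$ is strictly unimodular or $A$ is unimodular. (2) The $L_\infty$ algebra $A\otimes V$ admits a unimodular lift if and only if either $V$ admits a unimodular lift or $A$ is unimodular.
   Context: Conventions: the ground field $\mathbf k$ has characteristic zero; vector spaces are $\mathbb Z/2$-graded, $|x|$ is the parity, $\Pi$ is parity reversion, ''dg'' means differential $\mathbb Z/2$-graded; traces are supertraces (signs by the Koszul rule). For a finite-dimensional dg vector space $W$, $\hat S W^*$ is the completed symmetric algebra on $W^*$ (formal power series), $\hat S_{\ge n}W^*$ is the ideal of series whose monomials all have length at least $n$, and $\mathrm{Der}_{\ge n}(\hat S W^* )$ is the space of continuous derivations mapping $W^*$ into $\hat S_{\ge n}W^*$. The differential of $W$ extends to an odd derivation $d$ of $\hat SW^*$ and acts on derivations by $d(\xi)=[d,\xi]$. An $L_\infty$ structure on $V$ is an odd $m\in\mathrm{Der}_{\ge2}(\hat S\Pi V^* )$ with $d(m)+\frac12[m,m]=0$. Equivalently, via symmetrization and dualization of the components $m_n\colon \Pi V^*\to \hat S^n\Pi V^*$, it is given by odd graded-symmetric multilinear maps $\tilde m_n\colon(\Pi V)^{\otimes n}\to\Pi V$, $n\ge2$. Divergence: for $\xi=\sum_i f_i\partial_{x_i}\in \mathrm{Der}(\hat SW^* )$, with $(x_i)$ a homogeneous basis of $W^*$,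 $\nabla\xi=\sum_i(-1)^{|f_i||x_i|}\partial_{x_i}f_i$. A unimodular lift of an $L_\infty$ structure $m$ on $V$ is an even $f\in\hat S_{\ge1}\Pi V^*$ with $d(f)+\frac12\nabla(m)+m(f)=0$. The $L_\infty$ algebra $(V,m)$ is strictly unimodular if $f=0$ is a unimodular lift, i.e. $\nabla(m)=0$. A finite-dimensional cdga $A$ is unimodular if for every $a\in A$ the operator $x\mapsto ax$ on $A$ has zero (super)trace. Tensor product: $A\otimes V$ has the tensor product differential and, identifying $\Pi(A\otimes V)$ with $A\otimes\Pi V$, structure maps $\tilde m_n^{A\otimes V}(a_1\otimes v_1,\dots,a_n\otimes v_n)=\pm a_1\cdots a_n\otimes\tilde m_n(v_1,\dots,v_n)$, $n\ge 2$, with Koszul signs. *)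

(* Defs.v *)
From HB Require Import structures.
From mathcomp Require Import all_boot all_order all_algebra.
From mathcomp Require Import boolp functions.
Set Implicit Arguments.
Unset Strict Implicit.
Unset Printing Implicit Defensive.
Import GRing.Theory.
Local Open Scope ring_scope.

(** * Formal power series in graded variables

    For a Z/2-graded vector space W with a finite homogeneous basis indexed by
    [I], of parities [p : I -> bool] ([true] is odd), the dual basis (x_i) of
    W^* has the same parities, and the completed symmetric algebra of W^* is
    the algebra of formal power series in graded-commuting variables x_i.
    A monomial x^e is the product of the x_i ^ (e i) written in the order of
    [enum I]; the exponent of an odd variable is at most 1. *)

Section Series.
Variables (K : fieldType) (I : finType) (p : I -> bool).

Definition admissible (e : {ffun I -> nat}) : bool :=
  [forall i, p i ==> (e i <= 1)%N].

Definition monom := {e : {ffun I -> nat} | admissible e}.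

Definition series := monom -> K^o.
HB.instance Definition _ := GRing.Lmodule.on series.

Definition mlen (e : {ffun I -> nat}) : nat := \sum_i e i.
Definition mpar (e : {ffun I -> nat}) : bool := odd (\sum_(i | p i) e i).

Definition before (j i : I) : bool := (enum_rank j < enum_rank i)%N.

(* The coefficient of x^e, extended by 0 to the exponents e for which x^e
   vanishes because an odd variable is squared. *)
Definition coef (f : series) (e : {ffun I -> nat}) : K :=
  if insub e is Some a then f a else 0.

Definition sone : series := fun a => (val a == [ffun=> 0%N])%:R.
Definition svar (i : I) : series :=
  fun a => (val a == [ffun j => nat_of_bool (j == i)])%:R.

(* x^u * x^v = (-1)^(swaps u v) x^(u + v) *)
Definition swaps (u v : {ffun I -> nat}) : nat :=
  \sum_(i | p i) \sum_(j | p j && before j i) u i * v j.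

Definition smul (f g : series) : series := fun c =>
  \sum_(b : {ffun I -> 'I_(mlen (val c)).+1} | [forall i, (b i <= val c i)%N])
    let u := [ffun i => nat_of_ord (b i)] in
    let v := [ffun i => (val c i - u i)%N] in
    (-1) ^+ swaps u v * (coef f u * coef g v).

(* The left partial derivative with respect to x_i. *)
Definition pd (i : I) (f : series) : series := fun a =>
  (-1) ^+ (p i * \sum_(j | p j && before j i) val a j)
  * (coef f [ffun j => (val a j + (j == i))%N] *+ (val a i).+1).

Definition shomog (b : bool) (f : series) : Prop :=
  forall a, mpar (val a) != b -> f a = 0.

Definition order_ge (n : nat) (f : series) : Prop :=
  forall a, (mlen (val a) < n)%N -> f a = 0.

(* Continuity is with respect to the topology defined by the ideals
   [order_ge n]; for a linear map it is enough to require it at 0. *)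
Record is_derivation (b : bool) (D : series -> series) : Prop := IsDerivation {
  der_linear : linear D;
  der_parity : forall c f, shomog c f -> shomog (b (+) c) (D f);
  der_leibniz : forall c f g, shomog c f ->
    D (smul f g) = smul (D f) g + (-1) ^+ (b && c) *: smul f (D g);
  der_continuous : forall n, exists N,
    forall f, order_ge N f -> order_ge n (D f)
}.

(* D maps W^*, the span of the variables, into the series of order >= n. *)
Definition der_ge (n : nat) (D : series -> series) : Prop :=
  forall i, order_ge n (D (svar i)).

(* The graded commutator of operators of parities b and c. *)
Definition bracket (b c : bool) (D E : series -> series) : series -> series :=
  fun f => D (E f) - (-1) ^+ (b && c) *: E (D f).

Definition vfield (F : I -> series) : series -> series :=
  fun g => \sum_i smul (F i) (pd i g).

(* The divergence of a derivation xi = sum_i f_i d/dx_i of parity b, where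
   f_i = xi(x_i) has parity b + |x_i|. *)
Definition divergence (b : bool) (xi : series -> series) : series :=
  \sum_i (-1) ^+ ((b (+) p i) && p i) *: pd i (xi (svar i)).

Definition sword (w : seq I) : series := foldr (fun i f => smul (svar i) f) sone w.

(* The coefficient of x_{i_1} (x) ... (x) x_{i_n} in the symmetrization of f,
   where x_{i_1}...x_{i_n} is symmetrized to the sum over all permutations s of
   +- x_{i_s(1)} (x) ... (x) x_{i_s(n)}: the constant term of
   d/dx_{i_n} ... d/dx_{i_1} f. *)
Definition symmetrization (f : series) (w : seq I) : K :=
  coef (foldl (fun g i => pd i g) f w) [ffun=> 0%N].

(* The Koszul sign of
     x_{i_1} (x) ... (x) x_{i_n} (x) e_{i_1} (x) ... (x) e_{i_n}
       |-> x_{i_1} (x) e_{i_1} (x) ... (x) x_{i_n} (x) e_{i_n},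
   namely (-1) to the number of pairs of odd letters in the word. *)
Definition word_sign (w : seq I) : K := (-1) ^+ 'C(count p w, 2).

End Series.

Arguments svar K {I} p i.
Arguments sword K {I} p w.

(* A finite-dimensional Z/2-graded vector space, with a homogeneous basis (e_i)
   and the dual basis (x_i). *)
Record gspace (K : fieldType) := GSpace {
  gcar :> lmodType K;
  gidx : finType;
  gpar : gidx -> bool;
  gbase : gidx -> gcar;
  gdual : gidx -> {scalar gcar};
  gdual_base : forall i j, gdual i (gbase j) = (i == j)%:R;
  gbase_dual : forall v, v = \sum_i gdual i v *: gbase i
}.

Section GSpace.
Variables (K : fieldType) (W : gspace K).

Definition homog (b : bool) (v : W) : Prop :=
  forall i, @gpar K W i != b -> @gdual K W i v = 0.

Definition supertrace (phi : W -> W) : K :=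
  \sum_i (-1) ^+ @gpar K W i * @gdual K W i (phi (gbase i)).

End GSpace.

Record dgspace (K : fieldType) := DGSpace {
  dg_gspace :> gspace K;
  dg_d : {linear dg_gspace -> dg_gspace};
  dg_d_odd : forall b (v : dg_gspace), homog b v -> homog (~~ b) (dg_d v);
  dg_d_sq : forall v, dg_d (dg_d v) = 0
}.

Arguments gidx {K} W : rename.
Arguments gpar {K} W i : rename.
Arguments gbase {K} W i : rename.
Arguments gdual {K} W i : rename.
Arguments dg_d {K} W : rename.

(* A is not assumed to have a unit. *)
Record cdga (K : fieldType) := CDGA {
  cdga_dg :> dgspace K;
  cdga_mul : cdga_dg -> cdga_dg -> cdga_dg;
  cdga_mul_linl : forall y, linear (cdga_mul^~ y);
  cdga_mul_linr : forall x, linear (cdga_mul x);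
  cdga_mulA : associative cdga_mul;
  cdga_mul_homog : forall b c x y, homog b x -> homog c y ->
    homog (b (+) c) (cdga_mul x y);
  cdga_mulC : forall b c x y, homog b x -> homog c y ->
    cdga_mul x y = (-1) ^+ (b && c) *: cdga_mul y x;
  cdga_leibniz : forall b x y, homog b x ->
    dg_d cdga_dg (cdga_mul x y) =
      cdga_mul (dg_d cdga_dg x) y + (-1) ^+ b *: cdga_mul x (dg_d cdga_dg y)
}.

Arguments cdga_mul {K} A : rename.

Definition cdga_unimodular (K : fieldType) (A : cdga K) : Prop :=
  forall a : A, supertrace (cdga_mul A a) = 0.

(** ** Parity reversion

    The underlying space and the differential are unchanged.  (With the other
    convention, d_{Pi V} = - d_V, the isomorphism between Pi (A (x) V) and
    A (x) Pi V carries a sign; here it is the identity on a (x) v.) *)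

Section Pi.
Variables (K : fieldType) (V : dgspace K).

Definition Pi_gspace : gspace K :=
  @GSpace K V (gidx V) (fun i => ~~ gpar V i) (gbase V) (gdual V)
    (@gdual_base K V) (@gbase_dual K V).

Lemma Pi_homog b (v : V) : @homog K Pi_gspace b v <-> homog (~~ b) v.
Proof.
by split=> h i; have := h i; rewrite /=; case: (gpar V i); case: b {h}.
Qed.

Lemma Pi_d_odd b (v : V) :
  @homog K Pi_gspace b v -> @homog K Pi_gspace (~~ b) (dg_d V v).
Proof. by move=> /Pi_homog h; apply/Pi_homog/dg_d_odd. Qed.

Definition Pi : dgspace K :=
  @DGSpace K Pi_gspace (dg_d V) Pi_d_odd (@dg_d_sq K V).

End Pi.

Section Tensor.
Variables (K : fieldType) (A V : dgspace K).

Definition tcar := {ffun gidx A * gidx V -> K^o}.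
HB.instance Definition _ := GRing.Lmodule.on tcar.

Definition tpure (a : A) (v : V) : tcar :=
  [ffun ij => gdual A ij.1 a * gdual V ij.2 v].

Definition tpar (ij : gidx A * gidx V) : bool := gpar A ij.1 (+) gpar V ij.2.
Definition tbase (ij : gidx A * gidx V) : tcar :=
  tpure (gbase A ij.1) (gbase V ij.2).

Definition tdual (ij : gidx A * gidx V) (t : tcar) : K := t ij.
Lemma tdual_is_scalar ij : scalar (tdual ij).
Proof. by move=> c s t; rewrite /tdual !ffunE. Qed.
HB.instance Definition _ ij :=
  GRing.isLinear.Build K tcar K *%R (tdual ij) (tdual_is_scalar ij).

Lemma tdual_base ij kl : tdual ij (tbase kl) = (ij == kl)%:R.
Proof.
rewrite /tdual ffunE !gdual_base -natrM mulnb.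
by case: ij kl => [i j] [k l].
Qed.

Lemma tbase_dual t : t = \sum_ij tdual ij t *: tbase ij.
Proof.
apply/ffunP=> kl; rewrite sum_ffunE (bigD1 kl) //= ffunE.
have -> : tbase kl kl = 1 by rewrite -[LHS]/(tdual kl _) tdual_base eqxx.
rewrite [X in _ + X]big1 ?addr0 => [|ij ne]; first by rewrite [RHS]mulr1.
rewrite ffunE; have -> : tbase ij kl = 0; last by rewrite scaler0.
by rewrite -[LHS]/(tdual kl _) tdual_base eq_sym (negPf ne).
Qed.

Definition tgspace : gspace K :=
  @GSpace K tcar _ tpar tbase (fun ij => tdual ij) tdual_base tbase_dual.

(* d (a (x) v) = d a (x) v + (-1)^|a| a (x) d v *)
Definition td (t : tcar) : tcar :=
  \sum_ij tdual ij t *: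
    (tpure (dg_d A (gbase A ij.1)) (gbase V ij.2)
     + (-1) ^+ gpar A ij.1 *: tpure (gbase A ij.1) (dg_d V (gbase V ij.2))).

Lemma td_is_linear : linear td.
Proof.
move=> c s t; rewrite /td scaler_sumr -big_split; apply: eq_bigr => ij _ /=.
by rewrite linearP scalerDl scalerA.
Qed.
HB.instance Definition _ :=
  GRing.isLinear.Build K tcar tcar *:%R td td_is_linear.

Lemma gbase_homog (W : gspace K) i : @homog K W (gpar W i) (gbase W i).
Proof.
by move=> j ne; rewrite gdual_base; case: eqP => // e; rewrite e eqxx in ne.
Qed.

Lemma tpure_homog b c a v : homog b a -> homog c v ->
  @homog K tgspace (b (+) c) (tpure a v).
Proof.
move=> ha hv [i j]; rewrite /= /tpar /tdual ffunE /= => ne.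
have [/ha ->|/negPn/eqP eb] := boolP (gpar A i != b); first by rewrite mul0r.
have [/hv ->|/negPn/eqP ec] := boolP (gpar V j != c); first by rewrite mulr0.
by rewrite eb ec eqxx in ne.
Qed.

Lemma td_tpure b a v : homog b a ->
  td (tpure a v)
  = tpure (dg_d A a) v + (-1) ^+ b *: tpure a (dg_d V v).
Proof.
move=> ha; apply/ffunP=> -[k l]; rewrite sum_ffunE !ffunE /=.
have dE (W : dgspace K) m (w : W) :
    gdual W m (dg_d W w) = \sum_i gdual W i w * gdual W m (dg_d W (gbase W i)).
  rewrite {1}(gbase_dual w) !linear_sum; apply: eq_bigr => i _.
  by rewrite !linearZ.
have cE (W : dgspace K) m (w : W) :
    gdual W m w = \sum_i gdual W i w * gdual W m (gbase W i).
  by rewrite {1}(gbase_dual w) linear_sum; apply: eq_bigr => i _; rewrite linearZ.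
transitivity (\sum_i \sum_j (tdual (i, j) (tpure a v) *:
    (tpure (dg_d A (gbase A i)) (gbase V j)
     + (-1) ^+ gpar A i *: tpure (gbase A i) (dg_d V (gbase V j)))) (k, l)).
  by rewrite pair_bigA; apply: eq_bigr => -[].
rewrite (cE V l v) (cE A k a) !dE !mulr_suml scaler_sumr -big_split /=.
apply: eq_bigr => i _.
rewrite !mulr_sumr scaler_sumr -big_split /=; apply: eq_bigr => j _.
rewrite /tdual !ffunE /=.
have [/ha ->|/negPn/eqP ->] := boolP (gpar A i != b).
  by rewrite !mul0r scaler0 scale0r addr0.
rewrite /GRing.scale /= mulrDr; congr (_ + _); first by rewrite mulrACA.
by rewrite mulrCA mulrACA.
Qed.

Lemma td_odd b (t : tgspace) : homog b t -> @homog K tgspace (~~ b) (td t).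
Proof.
move=> ht kl ne; rewrite /td linear_sum big1 // => ij _.
have [/ht h|/negPn/eqP eb] := boolP (@gpar K tgspace ij != b).
  by rewrite (_ : tdual ij t = 0) // scale0r linear0.
have hA := @gbase_homog A ij.1; have hV := @gbase_homog V ij.2.
have e1 : (~~ gpar A ij.1) (+) gpar V ij.2 = ~~ b by rewrite addNb -eb.
have e2 : gpar A ij.1 (+) (~~ gpar V ij.2) = ~~ b by rewrite addbN -eb.
have := tpure_homog (dg_d_odd hA) hV; rewrite e1 => /(_ kl ne) h1.
have := tpure_homog hA (dg_d_odd hV); rewrite e2 => /(_ kl ne) h2.
by rewrite linearZ linearD linearZ /= (h1 : tdual _ _ = 0)
     (h2 : tdual _ _ = 0) mulr0 addr0 mulr0.
Qed.

Lemma td_sq t : td (td t) = 0.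
Proof.
rewrite {2}/td linear_sum big1 // => ij _; rewrite linearZ linearD linearZ /=.
rewrite (td_tpure _ (@gbase_homog A ij.1)).
rewrite (td_tpure _ (dg_d_odd (@gbase_homog A ij.1))) !dg_d_sq.
have z v : tpure 0 v = 0 by apply/ffunP=> kl; rewrite !ffunE linear0 mul0r.
have z' a : tpure a 0 = 0 by apply/ffunP=> kl; rewrite !ffunE linear0 mulr0.
rewrite z z' scaler0 add0r addr0 -scalerDl.
by case: (gpar A ij.1); rewrite /= ?expr0 ?expr1 ?subrr ?addNr scale0r scaler0.
Qed.

Definition tensor : dgspace K := @DGSpace K tgspace (@td) td_odd td_sq.

End Tensor.

Section Linfty.
Variables (K : fieldType) (V : dgspace K).

Definition Sym : Type := series K (gpar (Pi V)).
HB.instance Definition _ := GRing.Lmodule.on Sym.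

(* The derivation of [Sym] whose value on x_k is the Koszul dual
   (-1)^|x_k| (x_k o d) of the differential. *)
Definition dsym : Sym -> Sym :=
  vfield (fun k => \sum_i
    ((-1) ^+ gpar (Pi V) k * gdual (Pi V) k (dg_d (Pi V) (gbase (Pi V) i)))
      *: svar K (gpar (Pi V)) i).

Definition is_Linfty (m : Sym -> Sym) : Prop :=
  [/\ is_derivation true m,
      der_ge 2 m &
      forall g, bracket true true dsym m g
                + 2%:R^-1 *: bracket true true m m g = 0].

Definition unimodular_lift (m : Sym -> Sym) (f : Sym) : Prop :=
  [/\ shomog false f,
      order_ge 1 f &
      dsym f + 2%:R^-1 *: divergence true m + m f = 0].

Definition has_unimodular_lift (m : Sym -> Sym) : Prop :=
  exists f, unimodular_lift m f.

Definition strictly_unimodular (m : Sym -> Sym) : Prop := unimodular_lift m 0.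

(* Multilinear maps (Pi V)^{(x) n} -> Pi V, n >= 0, are given by their values
   on words in the basis.

   [mult_of m] and [of_mult mt] pass between a derivation m and the associated
   multilinear maps.  In both directions the dual of an odd multilinear map mt
   is x |-> (-1)^|x| (x o mt), and x_{i_1} (x) ... (x) x_{i_n} is paired with
   e_{i_1} (x) ... (x) e_{i_n} with the sign [word_sign]; equivalently
     sum_k m(x_k) e_k = - sum_n 1/n! mt(X, ..., X),   X = sum_i x_i e_i,
   where mt is extended to Sym (x) Pi V with the Koszul signs.  Symmetrization carries no factor 1/n!, so it is
   inverted by x_{i_1} (x) ... (x) x_{i_n} |-> 1/n! x_{i_1} ... x_{i_n}. *)

Definition mult_of (m : Sym -> Sym) (w : seq (gidx (Pi V))) : Pi V :=
  \sum_k ((-1) ^+ gpar (Pi V) k * word_sign K (gpar (Pi V)) w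
          * symmetrization (m (svar K (gpar (Pi V)) k)) w) *: gbase (Pi V) k.

Definition of_mult (mt : seq (gidx (Pi V)) -> Pi V) : Sym -> Sym :=
  vfield (fun k => fun a =>
    ((mlen (val a))`!%:R)^-1 *
    \sum_(w : (mlen (val a)).-tuple (gidx (Pi V)))
      (-1) ^+ gpar (Pi V) k * word_sign K (gpar (Pi V)) w
      * gdual (Pi V) k (mt w) * sword K (gpar (Pi V)) w a).

End Linfty.

Section TensorLinfty.
Variables (K : fieldType) (A : cdga K) (V : dgspace K).

(* e_{i_1} ... e_{i_n} for n >= 1; A need not have a unit, and only n >= 2 is used. *)
Definition aprod (s : seq (gidx A)) : A :=
  if s is i :: s' then foldl (fun x j => cdga_mul A x (gbase A j)) (gbase A i) s'
  else 0.

(* The parity of the Koszul sign of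
     mt (x) a_1 (x) v_1 (x) ... (x) a_n (x) v_n
       |-> a_1 (x) ... (x) a_n (x) mt (x) v_1 (x) ... (x) v_n
   for mt odd and v_j in Pi V: sum_j |a_j| + sum_(i < j) |v_i| |a_j|. *)
Fixpoint tensor_sign (s : seq (gidx A * gidx V)) : bool :=
  if s is (i, j) :: s' then
    gpar A i (+) (gpar (Pi V) j && odd (count (gpar A) (map fst s')))
      (+) tensor_sign s'
  else false.

Definition tensor_mult (mt : seq (gidx (Pi V)) -> Pi V)
    (s : seq (gidx (Pi (tensor A V)))) : Pi (tensor A V) :=
  if (2 <= size s)%N then
    (-1) ^+ tensor_sign s *: tpure (aprod (map fst s)) (mt (map snd s) : V)
  else 0.

Definition tensor_Linfty (m : Sym V -> Sym V) :
    Sym (tensor A V) -> Sym (tensor A V) :=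
  of_mult (tensor_mult (mult_of m)).

End TensorLinfty.

Arguments tensor_Linfty {K} A {V} m _ : rename.

(* Main.v *)
Require Import Defs.
From HB Require Import structures.
From mathcomp Require Import all_boot all_order all_algebra.
From mathcomp Require Import boolp functions.
From mathcomp Require Import ring zify.
Set Implicit Arguments.
Unset Strict Implicit.
Unset Printing Implicit Defensive.
Import GRing.Theory.
Local Open Scope ring_scope.

(** Everything is governed by the linear form t(x) = str(y |-> x y) on A, which is
    zero exactly when A is unimodular.

    Let (e_j) be a basis of A and x_(j,i) the coordinates on Pi(A (x) V).  The
    substitution x_i |-> sum_j x_(j,i) e_j extends a series g on Pi V to an A-valued
    series Phi(g) on Pi(A (x) V), and the tensor product structure M is
    characterized by M Phi(g) = Phi(m g).  Applying t to values gives
      M(t Phi(f)) = t Phi(m f),   d(t Phi(f)) = t Phi(d f),   div M = t Phi(div m).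
    The second identity holds because t vanishes on exact elements, and the third
    because contracting the output of a product with one of its factors is a
    trace over A.  If t = 0 then div M = 0, and 0 is a lift; if f is a unimodular
    lift of m, then t Phi(f) is one of M.

    Conversely, suppose that t is not zero.  Then there is an even idempotent u
    with t(u) <> 0 ([closed_idempotent_exists]); it is closed, since the Leibniz
    rule gives du = 2 u du and hence u du = 0.  So v |-> u (x) v is a strict
    morphism from V to A (x) V.  Restriction of series along it intertwines M with
    m, and sends t Phi(g) to t(u) g when g has no constant term.  Thus div M = 0
    gives t(u) div m = 0, and a unimodular lift F of M restricts to a solution of
    the equation of a lift of m, up to the nonzero factor t(u) in front of div m.

    The idempotent is found among the polynomials in an even element a with
    t(a) <> 0.  Let L be multiplication by a.  On the primary component of L for an
    irreducible polynomial p, the characteristic polynomial of L is a power of p, so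
    the trace of L is the dimension times the mean of the roots of p
    ([trace_primary]).  This is linear in the dimension, so it holds for
    supertraces and superdimensions as well.  Hence some component with p <> X has
    nonzero superdimension, and its projector is a polynomial in a without
    constant term.  No unit of A is involved, and K need not be algebraically
    closed.

    Identities between series are proved on symmetrizations, that is, on functions
    of words in the variables.  In characteristic zero [symmetrization] is
    injective and its image consists of the graded symmetric functions ([sym_inj],
    [sym_ser]).  Removing the first letter of a word is applying a partial
    derivative, so the Leibniz rule [pd_smul] turns the product of series into a
    shuffle product defined by recursion on the word ([sym_smul]); in this form Phi
    only multiplies a function of the letters in I by a function of the letters in
    J, and each of the identities above is an induction on the word
    ([had_shuffle], [lfield_had], [restrict_shuffle]). *)

(** * The Leibniz rule for series *)

Ltac case_odd :=
  repeat (match goal with |- context [odd ?n] => case: (odd n) end); by [].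

Section SeriesCalculus.
Variables (K : fieldType) (I : finType) (p : I -> bool).
Implicit Types (f g h : series K p) (u v c e : {ffun I -> nat}) (i j : I).

Definition incr i u : {ffun I -> nat} := [ffun j => (u j + (j == i))%N].

Definition expsub c u : {ffun I -> nat} := [ffun j => (c j - u j)%N].

(** The exponents of the divisors of x^c, with values in nat: in [smul] their type
    depends on c, but the Leibniz rule compares the divisors of x^c with those of
    its product with a variable. *)
Definition below c : seq {ffun I -> nat} :=
  [seq [ffun i => nat_of_ord (b i)]
    | b : {ffun I -> 'I_(mlen c).+1} <- enum {: {ffun I -> 'I_(mlen c).+1}} & [forall i, (b i <= c i)%N]].

Definition odd_before i u : nat := \sum_(j | p j && before j i) u j.
Definition odd_after i u : nat := \sum_(j | p j && before i j) u j.

Lemma coef_val f a : coef f (val a) = f a.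
Proof. by rewrite /coef valK. Qed.

Lemma coef_inadm f e : ~~ admissible p e -> coef f e = 0.
Proof. by move=> h; rewrite /coef insubN. Qed.

Lemma scoefP f g :
  (forall e, admissible p e -> coef f e = coef g e) -> f = g.
Proof.
by move=> h; apply/funext=> a; rewrite -!coef_val h // (valP a).
Qed.

Lemma scoefE f e (ae : admissible p e) : coef f e = f (Sub e ae).
Proof. by rewrite -(coef_val f (Sub e ae)) SubK. Qed.

Lemma scoefD f g e : coef (f + g) e = coef f e + coef g e.
Proof. by rewrite /coef; case: insubP => //=; rewrite addr0. Qed.

Lemma scoefZ (k : K) f e : coef (k *: f) e = k * coef f e.
Proof. by rewrite /coef; case: insubP => //=; rewrite mulr0. Qed.

Lemma scoef0 e : coef (0 : series K p) e = 0.
Proof. by rewrite /coef; case: insubP. Qed.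

Lemma coef_pd i f e :
  coef (pd i f) e
  = (-1) ^+ (p i * odd_before i e) * (coef f (incr i e) *+ (e i).+1).
Proof.
have [ae|nae] := boolP (admissible p e); first by rewrite scoefE.
rewrite !coef_inadm ?mul0rn ?mulr0 //.
apply: contra nae => /forallP h; apply/forallP=> j.
by apply/implyP=> pj; have := h j; rewrite pj ffunE; lia.
Qed.

Lemma leq_mlen c i : (c i <= mlen c)%N.
Proof. by rewrite /mlen (bigD1 i) //= leq_addr. Qed.

Lemma mem_below c u : (u \in below c) = [forall i, (u i <= c i)%N].
Proof.
apply/mapP/forallP => [[b]|h].
  by rewrite mem_filter => /andP[/forallP h _] -> i; rewrite ffunE.
have lt i : (u i < (mlen c).+1)%N by rewrite ltnS (leq_trans (h i)) ?leq_mlen.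
exists [ffun i => Ordinal (lt i)]; last by apply/ffunP=> i; rewrite !ffunE.
rewrite mem_filter mem_enum inE andbT; apply/forallP=> i.
by rewrite ffunE; apply: h.
Qed.

Lemma uniq_below c : uniq (below c).
Proof.
rewrite map_inj_uniq; first by rewrite filter_uniq ?enum_uniq.
move=> b b' /ffunP h; apply/ffunP=> i; apply: val_inj.
by have := h i; rewrite !ffunE.
Qed.

Lemma coef_smul f g c : admissible p c ->
  coef (smul f g) c
  = \sum_(u <- below c)
      (-1) ^+ swaps p u (expsub c u) * (coef f u * coef g (expsub c u)).
Proof.
move=> ac; rewrite scoefE /smul /below big_map big_filter SubK big_enum_cond.
exact: eq_bigl.
Qed.

(** Together with [below_incr_r], this rewrites a sum over the decompositions of c
    as one over those of c + 1_i, the missing terms being those in which one of the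
    factors is not divisible by x_i. *)
Lemma below_incr_l i c (G : {ffun I -> nat} -> K) :
  (forall u, u i = 0%N -> G u = 0) ->
  \sum_(u <- below c) G (incr i u) = \sum_(u <- below (incr i c)) G u.
Proof.
move=> G0; rewrite [RHS](bigID (fun u => u i == 0%N)) /=.
rewrite [X in _ = X + _]big1 ?add0r => [|u /eqP/G0//].
rewrite -[RHS]big_filter -[LHS](big_map (incr i) predT G).
apply/perm_big/uniq_perm.
- rewrite map_inj_uniq ?uniq_below // => u u' /ffunP h; apply/ffunP=> j.
  by have := h j; rewrite !ffunE => /addIn.
- by rewrite filter_uniq ?uniq_below.
move=> u; rewrite mem_filter mem_below; apply/mapP/andP => [[u']|[ui /forallP h]].
  rewrite mem_below => /forallP h ->; split; first by rewrite ffunE eqxx addn1.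
  by apply/forallP=> j; rewrite !ffunE leq_add2r.
exists [ffun j => (u j - (j == i))%N].
  rewrite mem_below; apply/forallP=> j; have := h j; rewrite !ffunE.
  by rewrite leq_subLR addnC.
by apply/ffunP=> j; rewrite !ffunE; case: eqP => [->|_] /=; move: ui; lia.
Qed.

Lemma below_incr_r i c (G : {ffun I -> nat} -> K) :
  (forall u, u i = (c i).+1 -> G u = 0) ->
  \sum_(u <- below c) G u = \sum_(u <- below (incr i c)) G u.
Proof.
move=> G0; rewrite [RHS](bigID (fun u => u i == (c i).+1)) /=.
rewrite [X in _ = X + _]big1 ?add0r => [|u /eqP/G0//].
rewrite -[RHS]big_filter; apply/perm_big/uniq_perm.
- exact: uniq_below.
- by rewrite filter_uniq ?uniq_below.
move=> u; rewrite mem_filter !mem_below; apply/forallP/andP => [h|[ui /forallP h] j].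
  split; first by have := h i; lia.
  by apply/forallP=> j; rewrite ffunE (leq_trans (h j)) ?leq_addr.
by have := h j; rewrite ffunE; case: eqP => [->|_]; move: ui; lia.
Qed.

Definition odd_len u : nat := \sum_(j | p j) u j.

Lemma before_total i j : i != j -> before i j = ~~ before j i.
Proof.
move=> ne; rewrite /before; suff: enum_rank i != enum_rank j :> nat by lia.
by rewrite (inj_eq val_inj) (inj_eq enum_rank_inj).
Qed.

Lemma before_irr i : before i i = false.
Proof. by rewrite /before ltnn. Qed.

Lemma odd_len_split i u : p i ->
  odd_len u = (odd_before i u + u i + odd_after i u)%N.
Proof.
move=> pi; rewrite /odd_len (bigD1 i) //= (bigID (fun j => before j i)) /=.
rewrite addnCA addnA; congr (_ + _ + _)%N.
  apply: eq_bigl => j; case: eqP => [->|_]; last by rewrite andbT.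
  by rewrite before_irr !andbF.
apply: eq_bigl => j; have [->|ne] := eqVneq j i.
  by rewrite before_irr !andbF.
by rewrite (before_total (i := i)) 1?eq_sym // andbT.
Qed.

Lemma swaps_sym u v :
  swaps p u v = (\sum_(j | p j) \sum_(i | p i && before j i) u i * v j)%N.
Proof.
rewrite /swaps (exchange_big_dep p) => [|i j pi /andP[]//] /=.
by apply: eq_bigr => j pj; apply: eq_bigl => i; rewrite pj.
Qed.

Lemma swaps_incrl i u v :
  swaps p (incr i u) v = (swaps p u v + p i * odd_before i v)%N.
Proof.
rewrite /swaps; have [pi|npi] := boolP (p i).
  rewrite (bigD1 i) //= [X in _ = (X + _)%N](bigD1 i) //= mul1n addnAC.
  congr (_ + _)%N.
    by rewrite -big_split; apply: eq_bigr => j _; rewrite ffunE eqxx addn1 mulSn addnC.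
  apply: eq_bigr => k /andP[_ ne]; apply: eq_bigr => j _.
  by rewrite ffunE (negPf ne) addn0.
rewrite mul0n addn0; apply: eq_bigr => k pk; apply: eq_bigr => j _.
rewrite ffunE; suff /negPf-> : k != i by rewrite addn0.
by apply: contraNneq npi => <-.
Qed.

Lemma swaps_incrr i u v :
  swaps p u (incr i v) = (swaps p u v + p i * odd_after i u)%N.
Proof.
rewrite !swaps_sym; have [pi|npi] := boolP (p i).
  rewrite (bigD1 i) //= [X in _ = (X + _)%N](bigD1 i) //= mul1n addnAC.
  congr (_ + _)%N.
    by rewrite -big_split; apply: eq_bigr => j _; rewrite ffunE eqxx addn1 mulnS addnC.
  apply: eq_bigr => k /andP[_ ne]; apply: eq_bigr => j _.
  by rewrite ffunE (negPf ne) addn0.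
rewrite mul0n addn0; apply: eq_bigr => k pk; apply: eq_bigr => j _.
rewrite ffunE; suff /negPf-> : k != i by rewrite addn0.
by apply: contraNneq npi => <-.
Qed.

Lemma odd_before_incr i u : odd_before i (incr i u) = odd_before i u.
Proof.
apply: eq_bigr => j /andP[_ b]; rewrite ffunE; case: eqP => [e|]; last by rewrite addn0.
by rewrite e before_irr in b.
Qed.

(** The grading automorphism, raised to the power [b]. *)
Definition stwist (b : bool) f : series K p :=
  fun a => (-1) ^+ (b && mpar p (val a)) * f a.

Lemma coef_stwist b f e : coef (stwist b f) e = (-1) ^+ (b && mpar p e) * coef f e.
Proof.
by rewrite /coef; case: insubP => [a _ <-|] //; rewrite mulr0.
Qed.

Lemma expsub_incr c u i : expsub (incr i c) (incr i u) = expsub c u.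
Proof. by apply/ffunP=> j; rewrite !ffunE subnDr. Qed.

Lemma expsub_incrr c u i : (u i <= c i)%N ->
  expsub (incr i c) u = incr i (expsub c u).
Proof.
move=> le; apply/ffunP=> j; rewrite !ffunE; case: eqP => [->|]; last by rewrite !addn0.
by rewrite addnBAC.
Qed.

Lemma eq_sign (a b : nat) : odd a = odd b -> (-1) ^+ a = (-1) ^+ b :> K.
Proof. by move=> e; rewrite -[LHS]signr_odd e signr_odd. Qed.

Lemma admissible_incr i c : admissible p c ->
  admissible p (incr i c) = ~~ (p i && (c i == 1%N)).
Proof.
move=> /forallP ac; apply/forallP/idP => [/(_ i)|h j].
  by rewrite ffunE eqxx; case: (p i) => //=; lia.
by have := ac j; rewrite ffunE; case: eqP => [->|_] /=; case: (p _) h => //=; lia.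
Qed.

(** The sign produced by moving d/dx_i to the monomial that it acts on is the
    number of odd variables it passes; the two terms of the Leibniz rule for the
    monomials x^u and x^v agree up to this sign with u_i and (-1)^(u_i) v_i,
    which add up to the exponent of x_i in the product. *)
Lemma pd_smul i f g :
  pd i (smul f g) = smul (pd i f) g + smul (stwist (p i) f) (pd i g).
Proof.
apply: scoefP => c ac; rewrite coef_pd scoefD (coef_smul (pd i f)) // (coef_smul (stwist _ _)) //.
pose v u := expsub (incr i c) u.
pose G1 u := (-1) ^+ (swaps p u (v u) + p i * (odd_before i u + odd_before i (v u)))
   * (coef f u * coef g (v u) *+ u i).
pose G2 u := (-1) ^+ (swaps p u (v u)
     + p i * (odd_after i u + odd_len u + odd_before i (v u)))
   * (coef f u * coef g (v u) *+ v u i).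
transitivity (\sum_(u <- below (incr i c)) (G1 u + G2 u)); last first.
  rewrite big_split -(@below_incr_l i c G1) => [|u u0]; last first.
    by rewrite /G1 u0 mulr0n mulr0.
  rewrite -(@below_incr_r i c G2) => [|u ui]; last first.
    by rewrite /G2 /v !ffunE ui eqxx addn1 subnn mulr0n mulr0.
  congr (_ + _); apply: eq_big_seq => u; rewrite mem_below => /forallP le.
    rewrite /G1 /v expsub_incr coef_pd ffunE eqxx addn1.
    rewrite -(mulr_natr (coef _ _)) -(mulr_natr (_ * _)).
    set x := coef _ _; set y := coef _ _; set n := _%:R.
    transitivity ((-1) ^+ (swaps p u (expsub c u) + p i * odd_before i u)
      * (x * y * n)); last by rewrite exprD; ring.
    congr (_ * _); apply: eq_sign; rewrite swaps_incrl odd_before_incr.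
    rewrite !(oddD, oddM, oddb); case: (p i) => /=; case_odd.
  rewrite /G2 /v expsub_incrr // swaps_incrr odd_before_incr coef_pd coef_stwist.
  rewrite [incr _ _ i]ffunE eqxx addn1 -(mulr_natr (coef _ _)) -(mulr_natr (_ * _)).
  set x := coef _ _; set y := coef _ _; set n := _%:R.
  transitivity ((-1) ^+ (swaps p u (expsub c u) + p i * odd_before i (expsub c u)
     + (p i && mpar p u)) * (x * y * n)); last by rewrite !exprD; ring.
  congr (_ * _); apply: eq_sign; rewrite /mpar -/(odd_len u) !(oddD, oddM, oddb).
  case: (p i) => /=; case_odd.
have obE u : (forall j, u j <= incr i c j)%N ->
    odd_before i c = (odd_before i u + odd_before i (v u))%N.
  move=> le; rewrite -(odd_before_incr i c) -big_split; apply: eq_bigr => j _ /=.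
  by rewrite [v u j]ffunE subnKC.
(* Here v_i comes with the sign of moving x_i across its u_i copies in x^u. *)
have GE u : (forall j, u j <= incr i c j)%N -> G1 u + G2 u =
    (-1) ^+ (p i * odd_before i c) * ((-1) ^+ swaps p u (v u)
      * (coef f u * coef g (v u) * ((u i)%:R + (-1) ^+ (p i * u i) * (v u i)%:R))).
  move=> le; rewrite /G1 /G2 -!(mulr_natr (_ * _)) mulrDr mulrDr mulrDr !mulrA.
  congr (_ + _).
    by rewrite (obE _ le) -exprD addnC.
  rewrite -!mulrA [_ * (coef g _ * ((-1) ^+ _ * _))]mulrCA !mulrA.
  transitivity ((-1) ^+ (p i * odd_before i c + swaps p u (v u) + p i * u i)
      * (coef f u * coef g (v u) * (v u i)%:R)); last by rewrite !exprD; ring.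
  rewrite -!mulrA; congr (_ * _); apply: eq_sign; rewrite (obE _ le).
  have [pi|_] := boolP (p i); last by rewrite !mul0n !addn0.
  rewrite (odd_len_split u pi) !mul1n !oddD.
  case_odd.
(* If x_i is odd and already occurs in x^c, the only decomposition left has
   u_i = v_i = 1, and its two contributions cancel. *)
have [ai|nai] := boolP (admissible p (incr i c)); last first.
  rewrite coef_inadm // mul0rn mulr0; apply/esym/big1_seq => u /=.
  rewrite mem_below => /forallP le; rewrite GE //.
  move: nai; rewrite admissible_incr // negbK => /andP[pi /eqP ci].
  have [au|/coef_inadm-> ] := boolP (admissible p u); last by rewrite !(mul0r, mulr0).
  have [av|/coef_inadm-> ] := boolP (admissible p (v u)); last by rewrite !(mul0r, mulr0).
  have := forallP au i; have := forallP av i; have := le i.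
  rewrite pi !ffunE eqxx /= => le1 le2 le3.
  have ui : u i = 1%N by move: le1 le2 le3; rewrite ci; case: (u i) => [|[|]].
  rewrite ui ci.
  by rewrite mul1n expr1 mulr1 subrr !mulr0.
rewrite coef_smul // -sumrMnl mulr_sumr; apply: eq_big_seq => u.
rewrite mem_below => /forallP le; rewrite GE // -mulrnAr -mulr_natr.
congr (_ * (_ * (_ * _))); have := le i; rewrite /v !ffunE eqxx.
move: ai; rewrite admissible_incr //.
have [pi|_ _ lei] := boolP (p i); last first.
  by rewrite mul0n mul1r -natrD subnKC // addn1.
have := forallP ac i; rewrite pi /= => ci' ci lei.
have c0 : c i = 0%N by move: ci' ci; case: (c i) => [|[|]].
rewrite c0 /= in lei *; have [->|->] : u i = 0%N \/ u i = 1%N.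
- by case: (u i) lei => [|[|]] // _; [left|right].
- by rewrite muln0 expr0 mul1r add0r.
by rewrite subnn mulr0 addr0.
Qed.

End SeriesCalculus.

(** * Functions on words and their shuffle product *)

(** The usual consequences of linearity, for maps such as [shuffle^~ psi] that are
    proved to be linear but carry no structure. *)
Section LinearMaps.
Variables (R : pzRingType) (U V : lmodType R) (f : U -> V) (lf : linear f).

Let g : {linear U -> V} := HB.pack f (GRing.isLinear.Build R U V *:%R f lf).

Lemma lin0 : f 0 = 0. Proof. exact: (linear0 g). Qed.
Lemma linD x y : f (x + y) = f x + f y. Proof. exact: (linearD g). Qed.
Lemma linB x y : f (x - y) = f x - f y. Proof. exact: (linearB g). Qed.
Lemma linZ a x : f (a *: x) = a *: f x. Proof. exact: (linearZ_LR g). Qed.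
Lemma lin_sum (J : Type) (r : seq J) (P : pred J) (F : J -> U) :
  f (\sum_(j <- r | P j) F j) = \sum_(j <- r | P j) f (F j).
Proof. exact: (linear_sum g). Qed.

End LinearMaps.

Section Words.
Variables (K : fieldType) (I : finType) (p : I -> bool).

Local Notation words := (seq I -> K^o).
Implicit Types (phi psi chi : words) (w : seq I) (i j : I) (b c : bool).

Definition wpar w : bool := odd (count p w).

Definition wshift i phi : words := fun w => phi (i :: w).

Definition wtwist b phi : words := fun w => (-1) ^+ (b && wpar w) * phi w.

(** The sum over all ways of splitting a word into two subwords, with the Koszul
    sign.  The recursion is the Leibniz rule: the first letter goes to [phi], or
    moves past [phi] to [psi]. *)
Fixpoint shuffle_at w phi psi : K :=
  if w is i :: w' then
    shuffle_at w' (wshift i phi) psi + shuffle_at w' (wtwist (p i) phi) (wshift i psi)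
  else phi [::] * psi [::].

Definition shuffle phi psi : words := fun w => shuffle_at w phi psi.

Definition whomog b phi : Prop := forall w, wpar w != b -> phi w = 0.

(** Graded symmetry, the property that characterizes symmetrizations. *)
Definition wsym phi : Prop := forall w i j w',
  phi (w ++ i :: j :: w') = (-1) ^+ (p i && p j) * phi (w ++ j :: i :: w').

Lemma wpar_cons i w : wpar (i :: w) = p i (+) wpar w.
Proof. by rewrite /wpar /= oddD oddb. Qed.

Lemma wpar_cat w w' : wpar (w ++ w') = wpar w (+) wpar w'.
Proof. by rewrite /wpar count_cat oddD. Qed.

Lemma wshiftZ i a phi : wshift i (a *: phi) = a *: wshift i phi.
Proof. by []. Qed.

Lemma wshift_sum (J : Type) (r : seq J) (P : pred J) (F : J -> words) i :
  wshift i (\sum_(j <- r | P j) F j) = \sum_(j <- r | P j) wshift i (F j).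
Proof. exact: (@lin_sum K _ _ (wshift i)). Qed.

Lemma wtwist_linear b : linear (wtwist b).
Proof.
move=> a phi psi; apply/funext=> w; rewrite /wtwist !fctE.
by rewrite /GRing.scale /=; ring.
Qed.

Lemma shuffle_linearl psi : linear (shuffle^~ psi).
Proof.
move=> a phi chi; apply/funext=> w.
change (shuffle_at w (a *: phi + chi) psi
  = a * shuffle_at w phi psi + shuffle_at w chi psi).
elim: w => [|i w IH] /= in phi chi psi *.
  by rewrite !fctE /GRing.scale /=; ring.
by rewrite wtwist_linear !IH; ring.
Qed.

Lemma shuffle_linearr phi : linear (shuffle phi).
Proof.
move=> a psi chi; apply/funext=> w.
change (shuffle_at w phi (a *: psi + chi)
  = a * shuffle_at w phi psi + shuffle_at w phi chi).
elim: w => [|i w IH] /= in phi chi psi *.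
  by rewrite !fctE /GRing.scale /=; ring.
by rewrite !IH; ring.
Qed.

Lemma wshift_shuffle i phi psi :
  wshift i (shuffle phi psi)
  = shuffle (wshift i phi) psi + shuffle (wtwist (p i) phi) (wshift i psi).
Proof. by []. Qed.

Lemma wordsP phi psi : phi [::] = psi [::] ->
  (forall i, wshift i phi = wshift i psi) -> phi = psi.
Proof.
move=> h0 h; apply/funext=> -[|i w] //.
by rewrite -[LHS]/(wshift i phi w) h.
Qed.

Lemma whomog_shift b phi i : whomog b phi -> whomog (b (+) p i) (wshift i phi).
Proof.
move=> h w ne; apply: h; rewrite wpar_cons.
by move: ne; case: (p i) (wpar w) b => -[] [].
Qed.

Lemma whomog_twist b c phi : whomog b phi -> wtwist c phi = (-1) ^+ (c && b) *: phi.
Proof.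
move=> h; apply/funext=> w; rewrite /wtwist fctE.
by have [/eqP->|/h->] := boolP (wpar w == b); rewrite ?scaler0 ?mulr0.
Qed.

Lemma wshift_twist b i phi :
  wshift i (wtwist b phi) = (-1) ^+ (b && p i) *: wtwist b (wshift i phi).
Proof.
apply/funext=> w; rewrite /wshift /wtwist fctE wpar_cons /GRing.scale /=.
by case: b (p i) (wpar w) => -[] [] /=; ring.
Qed.

Lemma wtwist_shuffle b phi psi :
  wtwist b (shuffle phi psi) = shuffle (wtwist b phi) (wtwist b psi).
Proof.
apply/funext=> w; elim: w => [|i w IH] in phi psi *.
  by rewrite /wtwist /shuffle /= /wtwist /= andbF /=; ring.
rewrite -[LHS]/(wshift i _ w) -[RHS]/(wshift i _ w) wshift_twist !wshift_shuffle.
rewrite !fctE (linD (wtwist_linear b)) !fctE !IH !wshift_twist.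
rewrite (linZ (shuffle_linearl _)) (linZ (shuffle_linearr _)) scalerDr.
congr (_ + _ *: shuffle _ _ w); apply/funext=> w'.
by rewrite /wtwist; ring.
Qed.

Lemma shuffleA phi psi chi :
  shuffle phi (shuffle psi chi) = shuffle (shuffle phi psi) chi.
Proof.
apply/funext=> w; elim: w => [|i w IH] in phi psi chi *.
  by rewrite /shuffle /= mulrA.
rewrite -[LHS]/(wshift i _ w) -[RHS]/(wshift i _ w) !wshift_shuffle.
rewrite (linD (shuffle_linearr _)) (linD (shuffle_linearl _)) !fctE !IH.
by rewrite addrA wtwist_shuffle.
Qed.

Lemma shuffleC b c phi psi : whomog b phi -> whomog c psi ->
  shuffle phi psi = (-1) ^+ (b && c) *: shuffle psi phi.
Proof.
move=> hb hc; apply/funext=> w; elim: w => [|i w IH] in b c phi psi hb hc *.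
  rewrite fctE /shuffle /=; case: b hb => [/(_ [::] isT)->|_]; last first.
    by rewrite mulrC scale1r.
  by rewrite mul0r mulr0 scaler0.
rewrite fctE -[LHS]/(wshift i _ w) -[shuffle _ _ (_ :: _)]/(wshift i _ w) !wshift_shuffle.
rewrite !fctE (whomog_twist _ hb) (whomog_twist _ hc).
rewrite !(linZ (shuffle_linearl _)) !fctE.
rewrite (IH _ _ _ _ (whomog_shift (i := i) hb) hc) (IH _ _ _ _ hb (whomog_shift (i := i) hc)) !fctE.
rewrite /GRing.scale /=.
by case: (p i) b c {hb hc} => -[] [] /=; ring.
Qed.

Lemma wsym_shift phi i : wsym phi -> wsym (wshift i phi).
Proof. by move=> h w; apply: (h (i :: w)). Qed.

Lemma wsym_move phi w i w' : wsym phi ->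
  phi (w ++ i :: w') = (-1) ^+ (p i && wpar w) * phi (i :: w ++ w').
Proof.
elim: w phi => [|j w IH] phi h /=; first by rewrite andbF mul1r.
rewrite -[LHS]/(wshift j phi _) IH; last exact: wsym_shift.
rewrite wpar_cons /wshift (h [::] j i) /= mulrA.
by congr (_ * _); case: (p i) (p j) (wpar w) => -[] [] /=; ring.
Qed.

End Words.

(** * Symmetrization of series *)

Section Symmetrization.
Variables (K : fieldType) (I : finType) (p : I -> bool).

Local Notation words := (seq I -> K^o).
Local Notation series := (series K p).
Local Notation sym := (@symmetrization K I p).
Implicit Types (f g h : series) (i j k : I) (w : seq I) (c phi : words).

Lemma pd_linear i : linear (@pd K I p i).
Proof.
move=> a f g; apply: scoefP => e ae.
by rewrite scoefD scoefZ !coef_pd scoefD scoefZ mulrnDl -mulrnAr mulrDr; ring.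
Qed.

Lemma smul_linearl g : linear (fun f => smul f g).
Proof.
move=> a f f'; apply: scoefP => e ae.
rewrite scoefD scoefZ !coef_smul // mulr_sumr -big_split /=; apply: eq_bigr => u _.
by rewrite scoefD scoefZ; ring.
Qed.

Lemma smul_linearr f : linear (smul f).
Proof.
move=> a g g'; apply: scoefP => e ae.
rewrite scoefD scoefZ !coef_smul // mulr_sumr -big_split /=; apply: eq_bigr => u _.
by rewrite scoefD scoefZ; ring.
Qed.

Lemma sym_shift i f : wshift i (sym f) = sym (pd i f).
Proof. by []. Qed.

Lemma sym_linear : linear (sym : series -> words).
Proof.
move=> a f g; apply/funext=> w.
change (sym (a *: f + g) w = a * sym f w + sym g w).
elim: w => [|i w IH] in f g *; first by rewrite /symmetrization scoefD scoefZ.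
by rewrite -!/(wshift i _ w) !sym_shift pd_linear IH.
Qed.

Lemma admissible0 : admissible p [ffun=> 0%N].
Proof. by apply/forallP=> i; rewrite ffunE implybT. Qed.

Lemma mlen_incr i (e : {ffun I -> nat}) : mlen (incr i e) = (mlen e).+1.
Proof.
rewrite /mlen -[RHS]addn1; under eq_bigr do rewrite ffunE.
rewrite big_split /=; congr (_ + _)%N.
by rewrite (bigD1 i) //= eqxx big1 // => j /negPf->.
Qed.

Lemma mpar_incr i (e : {ffun I -> nat}) : mpar p (incr i e) = p i (+) mpar p e.
Proof.
rewrite /mpar -[p i]oddb -oddD; congr odd; rewrite addnC.
under eq_bigr do rewrite ffunE.
rewrite big_split /=; congr (_ + _)%N.
have [pi|npi] := boolP (p i).
  by rewrite (bigD1 i) //= eqxx big1 // => j /andP[_ /negPf->].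
by rewrite big1 // => j pj; case: eqP => // e'; rewrite -e' pj in npi.
Qed.

Lemma mlen_eq0 (e : {ffun I -> nat}) : mlen e = 0%N -> e = [ffun=> 0%N].
Proof.
move=> h; apply/ffunP=> i; rewrite ffunE; apply/eqP.
by rewrite -leqn0 -h leq_mlen.
Qed.

Lemma mlen_posP (e : {ffun I -> nat}) n : mlen e = n.+1 ->
  exists i e', e = incr i e' /\ mlen e' = n.
Proof.
move=> h; have [i ei] : exists i, (0 < e i)%N.
  apply/existsP; rewrite -[X in is_true X]negbK; apply/negP=> /existsPn e0.
  have : mlen e = 0%N by apply: big1 => i _; have := e0 i; rewrite -eqn0Ngt => /eqP.
  by rewrite h.
have eE : e = incr i [ffun j => (e j - (j == i))%N].
  by apply/ffunP=> j; rewrite !ffunE; case: eqP => [->|_]; rewrite ?subnK ?subn0 ?addn0.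
exists i, [ffun j => (e j - (j == i))%N]; split=> //.
by move: h; rewrite {1}eE mlen_incr => -[].
Qed.

Lemma order_ge_pd n i f : order_ge n.+1 f -> order_ge n (pd i f).
Proof.
move=> h a lt; rewrite -coef_val coef_pd.
have [ae|nae] := boolP (admissible p (incr i (val a))).
  by rewrite scoefE h ?mul0rn ?mulr0 // SubK mlen_incr.
by rewrite coef_inadm ?mul0rn ?mulr0.
Qed.

Lemma shomog_pd b i f : shomog b f -> shomog (b (+) p i) (pd i f).
Proof.
move=> h a ne; rewrite -coef_val coef_pd.
have [ae|nae] := boolP (admissible p (incr i (val a))); last first.
  by rewrite coef_inadm ?mul0rn ?mulr0.
rewrite scoefE h ?mul0rn ?mulr0 // SubK mpar_incr.
by move: ne; case: (p i) (mpar _ _) b {h} => -[] [].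
Qed.

Lemma sym_order n f w : order_ge n f -> (size w < n)%N -> sym f w = 0.
Proof.
elim: w n f => [|i w IH] [|n] f // h lt.
  rewrite /symmetrization /= scoefE; first exact: admissible0.
  by move=> a; apply: h; rewrite SubK /mlen big1 // => i _; rewrite ffunE.
rewrite -[LHS]/(sym (pd i f) w); exact: IH (order_ge_pd _ h) lt.
Qed.

Lemma sym_homog b f : shomog b f -> whomog p b (sym f).
Proof.
move=> h w; elim: w b f h => [|i w IH] b f h ne.
  rewrite /symmetrization /= scoefE; first exact: admissible0.
  move=> a; apply: h; rewrite SubK /mpar big1 // => i _; first by rewrite ffunE.
rewrite -[LHS]/(sym (pd i f) w); apply: (IH (b (+) p i)); first exact: shomog_pd.
by move: ne; rewrite wpar_cons; case: (p i) (wpar _ _) b {h} => -[] [].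
Qed.

Lemma sym_twist b f : sym (stwist b f) = wtwist p b (sym f).
Proof.
apply/funext=> w; elim: w => [|i w IH] in f *.
  rewrite /symmetrization /wtwist /= coef_stwist /mpar /wpar /= !andbF big1 ?andbF //.
  by move=> i _; rewrite ffunE.
rewrite -[LHS]/(sym (pd i (stwist b f)) w) -[RHS]/(wshift i _ w).
rewrite wshift_twist sym_shift fctE -IH.
have -> : pd i (stwist b f) = (-1) ^+ (b && p i) *: stwist b (pd i f).
  apply: scoefP => e ae; rewrite scoefZ !coef_pd !coef_stwist coef_pd mpar_incr -mulrnAr.
  by case: (b) (p i) (mpar _ _) => -[] [] /=; ring.
by rewrite (linZ sym_linear).
Qed.

(** By induction on the word: both sides obey the same Leibniz rule. *)
Lemma sym_smul f g : sym (smul f g) = shuffle p (sym f) (sym g).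
Proof.
apply/funext=> w; elim: w => [|i w IH] in f g *.
  rewrite /symmetrization /shuffle /= coef_smul ?admissible0 //.
  have mem0 u : (u \in below [ffun=> 0%N]) = (u == [ffun=> 0%N]).
    rewrite mem_below; apply/forallP/eqP=> [h|-> i]; last by rewrite ffunE.
    by apply/ffunP=> i; have := h i; rewrite !ffunE leqn0 => /eqP.
  rewrite (perm_big [:: [ffun=> 0%N]]) /=; last first.
    by apply: uniq_perm => [||u]; [exact: uniq_below| |rewrite mem0 inE].
  rewrite big_seq1; have -> : expsub [ffun=> 0%N] [ffun=> 0%N] = [ffun=> 0%N] :> {ffun I -> nat}.
    by apply/ffunP=> i; rewrite !ffunE.
  rewrite /swaps big1 ?expr0 ?mul1r // => i _.
  by rewrite big1 // => j _; rewrite ffunE mul0n.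
rewrite -[RHS]/(wshift i _ w) -[LHS]/(sym (pd i (smul f g)) w) wshift_shuffle.
by rewrite pd_smul (linD sym_linear) !fctE !IH sym_twist.
Qed.

Lemma incrC i j (e : {ffun I -> nat}) : incr i (incr j e) = incr j (incr i e).
Proof. by apply/ffunP=> k; rewrite !ffunE addnAC. Qed.

Lemma odd_before_incr_neq i j (e : {ffun I -> nat}) :
  odd_before p i (incr j e) = (odd_before p i e + (p j && before j i))%N.
Proof.
rewrite /odd_before; under eq_bigr do rewrite ffunE.
rewrite big_split /=; congr (_ + _)%N.
have [h|h] := boolP (p j && before j i).
  by rewrite (bigD1 j) //= eqxx big1 // => k /andP[_ /negPf->].
by rewrite big1 // => k pk; case: eqP => // e'; rewrite -e' pk in h.
Qed.

Lemma pdC i j f : pd j (pd i f) = (-1) ^+ (p i && p j) *: pd i (pd j f).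
Proof.
apply: scoefP => e ae; rewrite scoefZ !coef_pd !odd_before_incr_neq incrC.
have [->|ne] := eqVneq i j.
  have [pj|_] := boolP (p j); last by rewrite /= expr0 !mul1r.
  rewrite coef_inadm ?mul0rn ?mulr0 ?mul0rn ?mulr0 //.
  by apply/forallPn; exists j; rewrite pj !ffunE eqxx; lia.
rewrite [incr j e i]ffunE [incr i e j]ffunE (negPf ne) eq_sym (negPf ne) !addn0.
rewrite (before_total ne).
rewrite !(mulrnAr, mulrnAl) mulrnAC; congr (_ *+ _ *+ _).
rewrite !mulrA; congr (_ * _); rewrite -!exprD; apply: eq_sign.
rewrite !(oddD, oddM, oddb).
by case: (p i) (p j) (before j i) (odd _) (odd _) => -[] [] [] [].
Qed.



Lemma sym_wsym f : wsym p (sym f).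
Proof.
move=> w i j w'; elim: w => [|k w IH] in f *; last exact: (IH (pd k f)).
change (sym (pd j (pd i f)) w' = (-1) ^+ (p i && p j) * sym (pd i (pd j f)) w').
by rewrite pdC (linZ sym_linear).
Qed.

Lemma admissible_delta i : admissible p [ffun j => nat_of_bool (j == i)].
Proof. by apply/forallP=> j; rewrite ffunE leq_b1 implybT. Qed.

Lemma coef_sone (e : {ffun I -> nat}) :
  coef (@sone K I p) e = (e == [ffun=> 0%N])%:R.
Proof.
have [ae|nae] := boolP (admissible p e); first by rewrite scoefE /sone SubK.
by rewrite coef_inadm //; case: eqP => // e0; rewrite e0 admissible0 in nae.
Qed.

Lemma coef_svar i (e : {ffun I -> nat}) :
  coef (svar K p i) e = (e == [ffun j => nat_of_bool (j == i)])%:R.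
Proof.
have [ae|nae] := boolP (admissible p e); first by rewrite scoefE /svar SubK.
by rewrite coef_inadm //; case: eqP => // e0; rewrite e0 admissible_delta in nae.
Qed.

Lemma pd_sone i : pd i (@sone K I p) = 0.
Proof.
apply: scoefP => e _; rewrite coef_pd scoef0 coef_sone.
case: eqP => [/ffunP/(_ i)|_]; last by rewrite mul0rn mulr0.
by rewrite !ffunE eqxx addn1.
Qed.

Lemma pd_svar i j : pd i (svar K p j) = (i == j)%:R *: (@sone K I p).
Proof.
apply: scoefP => e _; rewrite coef_pd scoefZ coef_sone coef_svar.
have [<-|ne] := eqVneq i j; last first.
  case: eqP => [/ffunP/(_ i)|_]; last by rewrite mul0rn mulr0 mul0r.
  by rewrite !ffunE eqxx (negPf ne) addn1.
have -> : (incr i e == [ffun j0 => nat_of_bool (j0 == i)]) = (e == [ffun=> 0%N]).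
  apply/eqP/eqP => [/ffunP h|->]; apply/ffunP=> k; last by rewrite !ffunE.
  by have := h k; rewrite !ffunE; apply: (@addIn _ _ 0%N).
case: eqP => [->|_]; last by rewrite mul0rn !mulr0.
rewrite ffunE mulr1n mulr1 /odd_before big1 => [|k _]; last exact: ffunE.
by rewrite muln0 expr0 mulr1.
Qed.

Lemma shomog_svar i : shomog (p i) (svar K p i).
Proof.
move=> a; rewrite /svar; have [->|//] := eqVneq (val a) _; rewrite /mpar.
have [pi|npi] := boolP (p i).
  rewrite (bigD1 i) //= ffunE eqxx big1 // => j /andP[_ /negPf ne].
  by rewrite ffunE ne.
rewrite big1 // => j pj; rewrite ffunE; case: eqP => // e.
by rewrite -e pj in npi.
Qed.

Lemma shomog_sone : shomog false (@sone K I p).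
Proof.
move=> a; rewrite /sone; have [->|//] := eqVneq (val a) _.
by rewrite /mpar big1 // => i _; rewrite ffunE.
Qed.

Lemma stwist_homog b b' f : shomog b' f -> stwist b f = (-1) ^+ (b && b') *: f.
Proof.
move=> h; apply/funext=> a; rewrite /stwist fctE.
by have [/eqP->|/h->] := boolP (mpar p (val a) == b'); rewrite ?scaler0 ?mulr0.
Qed.

Lemma pd_svar_smul i k g : pd i (smul (svar K p k) g) =
  (i == k)%:R *: smul (@sone K I p) g + (-1) ^+ (p i && p k) *: smul (svar K p k) (pd i g).
Proof.
rewrite pd_smul pd_svar (stwist_homog _ (@shomog_svar k)).
by rewrite !(linZ (smul_linearl _)).
Qed.

Lemma mlen_delta i : mlen [ffun j => nat_of_bool (j == i)] = 1%N.
Proof.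
rewrite /mlen (bigD1 i) //= ffunE eqxx big1 // => j /negPf ne.
by rewrite ffunE ne.
Qed.

Definition sdeg n f : Prop := forall e, mlen e != n -> coef f e = 0.

Lemma mlen_below (e u : {ffun I -> nat}) : u \in below e ->
  mlen e = (mlen u + mlen (expsub e u))%N.
Proof.
rewrite mem_below => /forallP le; rewrite /mlen -big_split /=.
by apply: eq_bigr => i _; rewrite ffunE subnKC.
Qed.

Lemma sdeg_svar_smul n k f : sdeg n f -> sdeg n.+1 (smul (svar K p k) f).
Proof.
move=> h e ne; have [ae|/coef_inadm//] := boolP (admissible p e).
rewrite coef_smul //; apply: big1_seq => u /= /mlen_below eE; rewrite coef_svar.
case: eqP => [ue|]; last by rewrite mul0r mulr0.
by rewrite h ?mulr0 //; move: ne; rewrite eE ue mlen_delta eqSS.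
Qed.

Lemma order_ge_smul n f g : order_ge n g -> order_ge n (smul f g).
Proof.
move=> h a lt; rewrite -coef_val coef_smul ?(valP a) //.
apply: big1_seq => u /= /mlen_below eE.
have [ae|/coef_inadm->] := boolP (admissible p (expsub (val a) u)); last by rewrite !mulr0.
by rewrite (scoefE g ae) h ?mulr0 // SubK (leq_ltn_trans _ lt) // eE leq_addl.
Qed.

(** The polynomial whose symmetrization is n! times the part of [c] on words of
    length n, when [c] is graded symmetric. *)
Fixpoint hsum n c : series :=
  if n is n'.+1 then \sum_k smul (svar K p k) (hsum n' (wshift k c))
  else c [::] *: (@sone K I p).

(** Inverse of the symmetrization on graded symmetric functions. *)
Definition ser c : series := fun a =>
  ((mlen (val a))`!%:R)^-1 * hsum (mlen (val a)) c a.

Lemma hsum_tuple n c : hsum n c = \sum_(w : n.-tuple I) c w *: sword K p w.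
Proof.
elim: n => [|n IH] in c *.
  rewrite (big_pred1 [tuple]) // => w; exact/esym/eqP/tuple0.
rewrite [LHS]/=; under eq_bigr do rewrite IH (lin_sum (smul_linearr _)).
rewrite pair_bigA /= (reindex (fun kw : I * n.-tuple I => cons_tuple kw.1 kw.2)) /=.
  by apply: eq_bigr => -[k w] _; rewrite (linZ (smul_linearr _)).
exists (fun w : n.+1.-tuple I => (thead w, [tuple of behead w])) => [[k w] _|w _] /=.
  by rewrite theadE; congr pair; apply: val_inj.
by rewrite [RHS]tuple_eta; apply: val_inj.
Qed.

Lemma hsumZ n x c : hsum n (x *: c) = x *: hsum n c.
Proof.
rewrite !hsum_tuple scaler_sumr; apply: eq_bigr => w _.
by rewrite scalerA.
Qed.

Lemma sdeg_hsum n c : sdeg n (hsum n c).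
Proof.
elim: n => [|n IH] in c * => e ne /=.
  rewrite scoefZ coef_sone; case: eqP => [e0|_]; last by rewrite mulr0.
  by move: ne; rewrite e0 /mlen big1 // => i _; rewrite ffunE.
rewrite (@lin_sum K _ _ (fun f => coef f e : K^o)); last first.
  by move=> a f g; rewrite scoefD scoefZ.
by apply: big1 => k _; apply: sdeg_svar_smul.
Qed.

Section CharZero.
Hypothesis charK0 : [pchar K] =i pred0.

Lemma char0_natS_neq0 n : (n.+1%:R : K) != 0.
Proof. by have /pcharf0P-> := charK0. Qed.

(** The partial derivatives of f have symmetrization zero as well, so by induction on
    the degree they vanish; a nonzero monomial of positive degree would be detected
    by one of them, as its exponents are invertible. *)
Lemma sym_eq0 f : sym f = 0 -> f = 0.
Proof.
move=> f0; apply: scoefP => e _; rewrite scoef0.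
move En: (mlen e) => n; elim: n => [|n IH] in f f0 e En *.
  by rewrite (mlen_eq0 En) -[LHS]/(sym f [::]) f0.
have [i [e' [eE En']]] := mlen_posP En.
have pd0 : sym (pd i f) = 0 by rewrite -sym_shift f0.
have := IH _ pd0 _ En'; rewrite coef_pd -eE => /eqP.
by rewrite mulf_eq0 signr_eq0 /= -mulr_natr mulf_eq0 (negPf (char0_natS_neq0 _)) orbF => /eqP.
Qed.

Lemma sym_inj f g : sym f = sym g -> f = g.
Proof.
move=> e; apply/subr0_eq/sym_eq0.
by rewrite (linB sym_linear) e subrr.
Qed.

Lemma smul1 f : smul (@sone K I p) f = f.
Proof.
apply: sym_inj; rewrite sym_smul; apply/funext=> w.
elim: w => [|i w IH] in f *.
  rewrite /shuffle /= {1}/symmetrization /= coef_sone eqxx mul1r //.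
rewrite -[LHS]/(wshift i _ w) wshift_shuffle sym_shift pd_sone.
rewrite (lin0 sym_linear) (lin0 (shuffle_linearl p _)) add0r.
rewrite -sym_twist (stwist_homog _ shomog_sone) andbF scale1r sym_shift.
exact: IH.
Qed.

Lemma smulA f g h : smul f (smul g h) = smul (smul f g) h.
Proof. by apply: sym_inj; rewrite !sym_smul shuffleA. Qed.

Lemma smulC b b' f g : shomog b f -> shomog b' g ->
  smul f g = (-1) ^+ (b && b') *: smul g f.
Proof.
move=> hf hg; apply: sym_inj; rewrite (linZ sym_linear) !sym_smul.
by apply: shuffleC; apply: sym_homog.
Qed.

(** Each of the n + 1 positions of the letter i contributes the same term, because
    the graded symmetry of [c] cancels the sign of moving x_i to the front. *)
Lemma pd_hsum n i c : wsym p c ->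
  pd i (hsum n.+1 c) = n.+1%:R *: hsum n (wshift i c).
Proof.
elim: n => [|n IH] in i c * => sc; rewrite [hsum _.+1 c]/= (lin_sum (pd_linear i)).
  rewrite (bigD1 i) //= pd_svar_smul eqxx (linZ (pd_linear _)) pd_sone scaler0.
  rewrite (lin0 (smul_linearr _)) scaler0 addr0 smul1 big1 ?addr0 // => k ne.
  rewrite pd_svar_smul eq_sym (negPf ne) scale0r add0r.
  by rewrite (linZ (pd_linear _)) pd_sone scaler0 (lin0 (smul_linearr _)) scaler0.
under eq_bigr do rewrite pd_svar_smul smul1.
rewrite big_split /= (bigD1 i) //= eqxx scale1r [X in _ + X + _]big1 => [|k ne]; last first.
  by rewrite eq_sym (negPf ne) scale0r.
rewrite addr0 [n.+2%:R]mulrS scalerDl scale1r; congr (_ + _).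
rewrite scaler_sumr; apply: eq_bigr => k _.
rewrite -[\sum_k0 smul _ _]/(hsum n.+1 (wshift k c)) IH; last exact: wsym_shift.
rewrite (linZ (smul_linearr _)) scalerA mulrC -scalerA; congr (_ *: _).
rewrite -(linZ (smul_linearr _)); congr smul.
have -> : wshift k (wshift i c) = (-1) ^+ (p i && p k) *: wshift i (wshift k c).
  by apply/funext=> w; apply: (sc [::] i k).
by rewrite hsumZ.
Qed.

Lemma pd_ser i c : wsym p c -> pd i (ser c) = ser (wshift i c).
Proof.
move=> sc; apply/funext=> a; set n := mlen (val a).
have -> : pd i (ser c) a = (n.+1`!%:R)^-1 * pd i (hsum n.+1 c) a.
  rewrite -!coef_val !coef_pd mulrCA; congr (_ * _); rewrite mulrnAr; congr (_ *+ _).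
  have [ae|nae] := boolP (admissible p (incr i (val a))); last first.
    by rewrite !coef_inadm ?mulr0.
  by rewrite !scoefE /ser SubK mlen_incr.
rewrite pd_hsum // fctE /ser -/n /GRing.scale /= mulrA; congr (_ * _).
by rewrite factS natrM invfM mulrAC mulVf ?mul1r ?char0_natS_neq0.
Qed.

Lemma sym_ser c : wsym p c -> sym (ser c) = c.
Proof.
move=> sc; apply/funext=> w; elim: w => [|i w IH] in c sc *.
  rewrite /symmetrization /= scoefE ?admissible0 // => a.
  rewrite /ser SubK /mlen big1 => [|i _]; last by rewrite ffunE.
  rewrite /= fctE -coef_val SubK coef_sone eqxx invr1 mul1r.
  exact: mulr1.
change (sym (pd i (ser c)) w = wshift i c w).
by rewrite pd_ser // IH //; apply: wsym_shift.
Qed.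

Lemma ser_sym f : ser (sym f) = f.
Proof. by apply/sym_inj/sym_ser/sym_wsym. Qed.

(** A series is a polynomial up to high order; this is what lets a continuous
    derivation be computed from its values on the variables. *)
Lemma truncate_ser N f :
  order_ge N (f - \sum_(n < N) (n`!%:R)^-1 *: hsum n (sym f)).
Proof.
move=> a lt; rewrite -{1}[f]ser_sym fctE fct_sumE.
change (ser (sym f) a - \sum_(n < N) ((n`!%:R)^-1 *: hsum n (sym f)) a = 0).
rewrite (bigD1 (Ordinal lt)) //= big1 => [|n ne]; first by rewrite addr0 subrr.
rewrite fctE -coef_val sdeg_hsum ?scaler0 //.
by apply: contraNneq ne => e; apply/eqP/val_inj.
Qed.

(** The grading automorphism acts on symmetrizations, so the parity of a series can
    be read off there. *)
Lemma shomog_sym b f : whomog p b (sym f) -> shomog b f.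
Proof.
move=> h a ne; have : f = (-1) ^+ b *: stwist true f.
  apply: sym_inj; rewrite (linZ sym_linear) sym_twist (whomog_twist _ h) scalerA.
  by rewrite -signr_addb addbb scale1r.
move=> /(congr1 (fun g : series => g a)); rewrite fctE /stwist /=.
move: ne; case: (mpar _ _) (b) => -[] //= _ /eqP.
  rewrite scale1r mulN1r -subr_eq0 opprK -mulr2n -mulr_natr mulf_eq0.
  by rewrite (negPf (char0_natS_neq0 _)) orbF => /eqP.
rewrite mul1r scaleN1r -subr_eq0 opprK -mulr2n -mulr_natr mulf_eq0.
by rewrite (negPf (char0_natS_neq0 _)) orbF => /eqP.
Qed.

Section Derivation.
Variables (m : series -> series) (dm : is_derivation true m).

Lemma der_sone : m (@sone K I p) = 0.
Proof.
have := der_leibniz dm (@sone K I p) shomog_sone.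
rewrite andbF expr0 scale1r !smul1.
rewrite (smulC (der_parity dm shomog_sone) shomog_sone) andbF expr0 scale1r smul1.
by move/eqP; rewrite -subr_eq0 opprD addNKr oppr_eq0 => /eqP.
Qed.

Lemma vfield_linear (F : I -> series) : linear (vfield F).
Proof.
move=> a f g; rewrite /vfield scaler_sumr -big_split; apply: eq_bigr => i _ /=.
by rewrite pd_linear smul_linearr.
Qed.

Lemma order_ge_vfield n (F : I -> series) f :
  order_ge n.+1 f -> order_ge n (vfield F f).
Proof.
move=> h a lt; rewrite /vfield fct_sumE; apply: big1 => i _.
by apply: (@order_ge_smul n) => //; apply: order_ge_pd.
Qed.

Lemma vfield_svar_smul (F : I -> series) k g :
  (forall i, shomog (~~ p i) (F i)) ->
  vfield F (smul (svar K p k) g)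
  = smul (F k) g + (-1) ^+ p k *: smul (svar K p k) (vfield F g).
Proof.
move=> hF; rewrite /vfield (lin_sum (smul_linearr _)) scaler_sumr.
under eq_bigr do rewrite pd_svar_smul smul1 (linD (smul_linearr _)) !(linZ (smul_linearr _)).
rewrite big_split /= (bigD1 k) //= eqxx scale1r big1 ?addr0 => [|i /negPf->]; last first.
  by rewrite scale0r.
congr (_ + _); apply: eq_bigr => i _.
rewrite !smulA (smulC (hF i) (@shomog_svar k)) (linZ (smul_linearl _)) scalerA.
by congr (_ *: _); case: (p i) (p k) => -[] /=; ring.
Qed.

(** A derivation is determined by the images of the variables: the difference
    with the corresponding vector field is a continuous odd derivation that kills
    the variables, hence all polynomials, hence all series. *)
Lemma derivation_vfield : m =1 vfield (fun i => m (svar K p i)).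
Proof.
pose F i := m (svar K p i).
move=> f; rewrite -[vfield _]/(vfield F); apply/subr0_eq; apply/funext=> a.
pose n := (mlen (val a)).+1.
have [N cN] := der_continuous dm n.
have lE : linear (fun g => m g - vfield F g).
  move=> x g h; rewrite (der_linear dm) vfield_linear scalerBr.
  by rewrite opprD addrACA.
have E0 l c : m (hsum l c) - vfield F (hsum l c) = 0.
  elim: l => [|l IH] in c *.
    rewrite /= (linZ lE) der_sone /vfield big1 ?subrr ?scaler0 // => i _.
    by rewrite pd_sone (lin0 (smul_linearr _)).
  rewrite /= (lin_sum lE); apply: big1 => i _.
  rewrite (der_leibniz dm _ (@shomog_svar i)) vfield_svar_smul => [|j]; last first.
    by have := der_parity dm (@shomog_svar j).
  rewrite -/(F i) opprD addrACA subrr add0r -scalerBr -(linB (smul_linearr _)) IH.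
  by rewrite (lin0 (smul_linearr _)) scaler0.
set M := maxn N n.+1.
have := truncate_ser (N := M) f; set g := \sum_(_ < _) _ => hg.
rewrite -[f](subrK g) (linD lE) [X in _ + X](_ : _ = 0) ?addr0; last first.
  by rewrite (lin_sum lE) big1 // => k _; rewrite (linZ lE) E0 scaler0.
have lt : (mlen (val a) < n)%N by [].
rewrite fctE (cN _ _ a lt) => [|b ltb]; last by rewrite hg // (leq_trans ltb) ?leq_maxl.
rewrite (_ : (- _) a = - vfield F (f - g) a) // (@order_ge_vfield n) ?subrr //.
by move=> b ltb; rewrite hg // (leq_trans ltb) ?leq_maxr.
Qed.

End Derivation.

End CharZero.
End Symmetrization.

(** * Idempotents of nonzero supertrace *)

Section Primary.
Variable (K : fieldType).
Implicit Types (p q u v w : {poly K}).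

Lemma coef_subleading p q d e : size p = d.+2 -> size q = e.+2 ->
  p \is monic -> q \is monic -> (p * q)`_(d + e).+1 = p`_d + q`_e.
Proof.
move=> sp sq mp mq; rewrite coefM.
have pd : p`_d.+1 = 1 by move/eqP: mp; rewrite lead_coefE sp.
have qe : q`_e.+1 = 1 by move/eqP: mq; rewrite lead_coefE sq.
have d1 : (d < (d + e).+2)%N by lia.
have d2 : (d.+1 < (d + e).+2)%N by lia.
rewrite (bigD1 (Ordinal d1)) //= (bigD1 (Ordinal d2)) /=; last first.
  by rewrite -val_eqE /=; lia.
rewrite [X in _ + (_ + X)]big1 ?addr0 => [|i /andP[]].
  have -> : ((d + e).+1 - d = e.+1)%N by lia.
  by rewrite subSS addKn pd qe mulr1 mul1r.
rewrite -!val_eqE /= => n1 n2.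
case: (ltngtP i d) n1 => // lt _.
  by rewrite (nth_default 0 (s := q)) ?mulr0 // sq; lia.
by rewrite (nth_default 0 (s := p)) ?mul0r // sp; lia.
Qed.

Lemma coef_subleading_exp p d j : size p = d.+2 -> p \is monic ->
  size (p ^+ j.+1) = (j.+1 * d.+1).+1 /\
  (p ^+ j.+1)`_(j.+1 * d.+1).-1 = j.+1%:R * p`_d.
Proof.
move=> sp mp; elim: j => [|j [sj IH]]; first by rewrite expr1 mul1n mul1r.
have mj := monic_exp j.+1 mp.
have s : size (p ^+ j.+2) = (j.+2 * d.+1).+1.
  rewrite exprS size_monicM ?monic_neq0 // sp sj; lia.
split=> //; rewrite exprS.
have sj' : size (p ^+ j.+1) = (j.+1 * d.+1).-1.+2 by rewrite sj; lia.
have -> : (j.+2 * d.+1).-1 = (d + (j.+1 * d.+1).-1).+1 by lia.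
by rewrite coef_subleading // IH [j.+2%:R]mulrS mulrDl mul1r.
Qed.

(** Over polynomials X - M divides p(X) - p(M), so its determinant divides that
    of the scalar matrix p(X) as soon as p(M) = 0. *)
Lemma char_poly_dvd_exp n (M : 'M[K]_n.+1) p :
  horner_mx M p = 0 -> char_poly M %| p ^+ n.+1.
Proof.
move=> pM; pose x : 'M[{poly K}]_n.+1 := 'X%:M; pose y := map_mx polyC M.
have cxy : y *m x = x *m y by apply: scalar_mxC.
have : exists Q, (x - y) *m Q = p%:M.
  have -> : p%:M = p%:M - map_mx polyC (horner_mx M p) :> 'M_n.+1.
    by rewrite pM map_mx0 subr0.
  elim/poly_ind: p {pM} => [|p c [Q IH]].
    by exists 0; rewrite !rmorph0 mulmx0 subr0.
  exists (Q *m x + map_mx polyC (horner_mx M p)).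
  have hE : horner_mx M (p * 'X + c%:P) = horner_mx M p *m M + c%:M.
    by rewrite rmorphD rmorphM /= horner_mx_X horner_mx_C.
  rewrite hE map_mxD map_mxM map_scalar_mx mulmxDr mulmxA IH /=.
  rewrite raddfD /= scalar_mxM -/x -/y mulmxBl opprD addrACA subrr addr0.
  set A := map_mx polyC _; have xA : A *m x = x *m A by apply: scalar_mxC.
  rewrite !mulmxBl xA addrA subrK; congr (_ - _).
  by rewrite /A /y -!map_mxM; congr map_mx; apply: comm_mx_horner.
case=> Q QE; have := congr1 determinant QE.
rewrite det_mulmx det_scalar => <-.
by rewrite dvdp_mulr // /char_poly /char_poly_mx dvdpp.
Qed.

Lemma monic_dvd_exp p q N : irreducible_poly p -> p \is monic ->
  q \is monic -> q %| p ^+ N -> exists j, q = p ^+ j.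
Proof.
move=> ip mp; elim: N q => [|N IH] q mq dq.
  by exists 0%N; move: dq; rewrite expr0 dvdp1 size_poly_eq1 eqp_monic ?monic1 // => /eqP.
have [pq|npq] := boolP (p %| q).
  have qE := divpK pq; have mq' : q %/ p \is monic.
    by move: mq; rewrite -{1}qE monicMr.
  have [|j jE] := IH _ mq'; last by exists j.+1; rewrite exprSr -jE.
  by move: dq; rewrite -{1}qE exprSr dvdp_mul2r ?monic_neq0.
exists 0%N; rewrite expr0.
have cop : coprimep q (p ^+ N.+1).
  by rewrite coprimep_expr // coprimep_sym irreducible_poly_coprime.
have : q %| 1 by rewrite -(Gauss_dvdpr 1 cop) mulr1.
by rewrite dvdp1 size_poly_eq1 eqp_monic ?monic1 // => /eqP.
Qed.

(** The factorization C R of an idempotent identifies its image with K^r; there M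
    acts by R M C, whose characteristic polynomial is a power p^j with j deg p = r.
    Its trace is minus the subleading coefficient of p^j, which is j times that of
    p. *)
Lemma trace_primary n r
    (M : 'M[K]_n.+1) (C : 'M_(n.+1, r)) (R : 'M_(r, n.+1)) p d k :
  R *m C = 1%:M -> M *m (C *m R) = (C *m R) *m M ->
  size p = d.+2 -> p \is monic -> irreducible_poly p ->
  horner_mx M (p ^+ k) *m (C *m R) = 0 ->
  d.+1%:R * \tr (M *m (C *m R)) = - p`_d * \tr (C *m R).
Proof.
move=> RC cME sp mp ip pk0; case: r C R RC cME pk0 => [|r] C R RC cME pk0.
  by rewrite (flatmx0 R) mulmx0 mulmx0 mxtrace0 !mulr0.
pose N : 'M_r.+1 := R *m M *m C.
have hN q : horner_mx N q = R *m horner_mx M q *m C.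
  elim/poly_ind: q => [|q c IH]; first by rewrite !rmorph0 mulmx0 mul0mx.
  rewrite !(rmorphD, rmorphM) /= !horner_mx_X !horner_mx_C mulmxDr mulmxDl.
  rewrite mul_mx_scalar -scalemxAl RC scalemx1; congr (_ + _).
  rewrite -[LHS]/(horner_mx N q *m N) IH /N -[_ * M]/(_ *m M).
  rewrite -!mulmxA; congr (_ *m (_ *m _)).
  by rewrite !mulmxA -[C *m R *m M]cME -!mulmxA RC mulmx1.
have pN : horner_mx N (p ^+ k) = 0.
  rewrite hN -[C]mulmx1 -RC -!mulmxA [_ *m (C *m (R *m C))](_ : _ = 0) ?mulmx0 //.
  by rewrite !mulmxA -(mulmxA _ C R) pk0 mul0mx.
have [] := monic_dvd_exp ip mp (char_poly_monic N) (N := (k * r.+1)%N).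
  by rewrite exprM; apply: char_poly_dvd_exp.
move=> j cE; have sj : (size (char_poly N)).-1 = r.+1 by rewrite size_char_poly.
have trN : \tr (M *m (C *m R)) = \tr N by rewrite mulmxA mxtrace_mulC mulmxA.
have trE : \tr (C *m R) = r.+1%:R by rewrite mxtrace_mulC RC mxtrace1.
rewrite trN trE -[\tr N]opprK -char_poly_trace // cE.
case: j cE => [|j] cE; first by move: sj; rewrite cE expr0 size_poly1.
have [sE coE] := coef_subleading_exp j sp mp.
have jd : (j.+1 * d.+1)%N = r.+1 by move: sj; rewrite cE sE.
by rewrite -jd coE !natrM; ring.
Qed.

Lemma irreducible_factor q : (1 < size q)%N ->
  exists p, [/\ irreducible_poly p, p \is monic & p %| q].
Proof.
have [n] := ubnP (size q); elim: n q => // n IH q lt s1.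
have q0 : q != 0 by rewrite -size_poly_gt0 (ltn_trans _ s1).
have [iq|niq] := pselect (irreducible_poly q).
  have l0 : (lead_coef q)^-1 != 0 by rewrite invr_eq0 lead_coef_eq0.
  exists ((lead_coef q)^-1 *: q); split; last by rewrite dvdpZl.
    split=> [|d sd]; first by rewrite size_scale.
    by rewrite dvdpZr // => /(iq.2 d sd) /eqp_trans-> //; rewrite eqp_sym eqp_scale.
  by rewrite monicE lead_coefZ mulVf // lead_coef_eq0.
have [d [sd dq nd]] : exists d : {poly K}, [/\ size d != 1%N, d %| q & ~~ (d %= q)].
  apply: contrapT => nex; apply: niq; split=> // d sd dq.
  by apply/negPn/negP=> nd; apply: nex; exists d.
have d0 : d != 0 by apply: contraNneq q0 => d0; rewrite d0 dvd0p in dq.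
have ltd : (size d < size q)%N.
  by rewrite ltn_neqAle dvdp_leq // andbT; apply: contra nd => e; rewrite -dvdp_size_eqp.
have [||p [ip mp pd]] := IH d.
- exact: leq_trans ltd _.
- by rewrite ltn_neqAle eq_sym sd size_poly_gt0.
by exists p; split=> //; apply: dvdp_trans dq.
Qed.

Lemma factor_out p q : irreducible_poly p -> q != 0 ->
  exists k q', q = p ^+ k * q' /\ ~~ (p %| q').
Proof.
move=> ip; have [n] := ubnP (size q); elim: n q => // n IH q lt q0.
have [pq|npq] := boolP (p %| q); last by exists 0%N, q; rewrite expr0 mul1r.
have qE := divpK pq; set q1 := q %/ p in qE.
have q10 : q1 != 0 by apply: contraNneq q0 => e; rewrite -qE e mul0r.
have lt1 : (size q1 < n)%N.
  move: lt ip.1; rewrite -qE size_mul ?(irredp_neq0 ip) //.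
  by move: (size q1) (size p) => a b; lia.
have [k [q' [q1E np]]] := IH q1 lt1 q10.
by exists k.+1, q'; split=> //; rewrite -qE q1E exprS; ring.
Qed.

Section Idempotent.
Hypothesis charK0 : [pchar K] =i pred0.
Variables (n : nat) (M P Q : 'M[K]_n.+1).
Hypotheses (PP : P *m P = P) (QQ : Q *m Q = Q)
  (MP : M *m P = P *m M) (MQ : M *m Q = Q *m M).

Local Notation str X := (\tr (X *m P) - \tr (X *m Q)).
Local Notation ev q := (horner_mx M q).

Let evM q q' : ev (q * q') = ev q *m ev q'.
Proof. by rewrite rmorphM. Qed.

Let evC q q' : ev q *m ev q' = ev q' *m ev q.
Proof. by rewrite -!evM mulrC. Qed.

Let evX : ev 'X = M. Proof. exact: horner_mx_X. Qed.

Lemma trace_primary_idem (E S : 'M[K]_n.+1) p d k :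
  S *m S = S -> E *m E = E -> M *m S = S *m M -> E *m S = S *m E -> M *m E = E *m M ->
  size p = d.+2 -> p \is monic -> irreducible_poly p ->
  ev (p ^+ k) *m E = 0 ->
  d.+1%:R * \tr (M *m E *m S) = - p`_d * \tr (E *m S).
Proof.
move=> SS EE MS ES ME sp mp ip pE.
have T : (E *m S) *m (E *m S) = E *m S.
  by rewrite mulmxA -(mulmxA E S) -ES !mulmxA EE -mulmxA SS.
have CR := mulmx_base (E *m S).
have RC : row_base (E *m S) *m col_base (E *m S) = 1%:M.
  apply: (row_free_inj (row_base_free (E *m S))).
  apply: (row_full_inj (col_base_full (E *m S))).
  by rewrite mul1mx CR -[_ *m row_base _]mulmxA CR mulmxA CR T.
rewrite -mulmxA -CR; apply: (trace_primary (k := k) RC _ sp mp ip); rewrite CR.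
- by rewrite mulmxA ME -!mulmxA MS.
- by rewrite mulmxA pE mul0mx.
Qed.

(** Splitting off the irreducible factors of the characteristic polynomial one at
    a time, some primary component of M carries a nonzero supertrace; on it the
    supertraces of M and of the identity are proportional. *)
Lemma idempotent_poly_step q w : q != 0 ->
  ev w *m ev w = ev w -> ev q *m ev w = 0 -> str (M *m ev w) != 0 ->
  exists w', [/\ ev w' *m ev w' = ev w', 'X %| w' & str (ev w') != 0].
Proof.
have [l] := ubnP (size q); elim: l q w => // l IH q w lt q0 ww qw sw.
have [s1|s1] := leqP (size q) 1.
  have [c c0 qc] : exists2 c, c != 0 & q = c%:P.
    by move: (size1_polyC s1) => ->; eexists; last by []; rewrite -polyC_eq0 -size1_polyC.
  move: qw; rewrite qc horner_mx_C mul_scalar_mx => /eqP.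
  by rewrite scaler_eq0 (negPf c0) => /eqP w0; rewrite w0 mulmx0 !mul0mx mxtrace0 subrr eqxx in sw.
have [p [ip mp pq]] := irreducible_factor s1.
have [k [q' [qE npq']]] := factor_out ip q0.
have q'0 : q' != 0 by apply: contraNneq q0 => e; rewrite qE e mulr0.
(* w1 projects onto the p-primary component, w2 onto its complement in the image
   of w. *)
have cop : coprimep (p ^+ k) q' by rewrite coprimep_expl // irreducible_poly_coprime.
have [[a b] /= ab1] := Bezout_eq1_coprimepP _ _ cop.
pose w1 := b * q' * w; pose w2 := a * p ^+ k * w.
have w12 : ev w1 + ev w2 = ev w by rewrite -rmorphD /= /w1 /w2 -mulrDl addrC ab1 mul1r.
have w1w2 : ev w1 *m ev w2 = 0.
  rewrite -evM (_ : w1 * w2 = (b * a * w) * (q * w)); last by rewrite qE /w1 /w2; ring.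
  by rewrite evM [ev (q * w)]evM qw mulmx0.
have wwl v : ev w *m ev (v * w) = ev (v * w).
  rewrite -evM (_ : _ * _ = v * (w * w)); last by ring.
  by rewrite evM [ev (w * w)]evM ww -evM.
have w11 : ev w1 *m ev w1 = ev w1.
  by rewrite -[RHS]wwl -/w1 -/w2 -w12 mulmxDl [ev w2 *m _]evC w1w2 addr0.
have w22 : ev w2 *m ev w2 = ev w2.
  by rewrite -[RHS]wwl -/w1 -/w2 -w12 mulmxDl w1w2 add0r.
have [s2|s2] := eqVneq (str (M *m ev w2)) 0; last first.
  apply: (IH q' w2) => //.
    have k0 : (0 < k)%N.
      by rewrite lt0n; apply: contraNneq npq' => k0; rewrite -[q']mul1r -(expr0 p) -k0 -qE.
    have sk : (0 < (size (p ^+ k)).-1)%N.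
      by rewrite size_exp muln_gt0 k0 andbT; have := ip.1; case: (size p) => [|[]].
    move: lt sk; rewrite qE size_mul ?expf_neq0 ?(irredp_neq0 ip) //.
    by move: (size q') (size (p ^+ k)) => x y; lia.
  rewrite -evM (_ : q' * w2 = a * (q * w)); last by rewrite qE /w2; ring.
  by rewrite evM [ev (q * w)]evM qw mulmx0.
have s1' : str (M *m ev w1) != 0.
  apply: contraNneq sw => s10; rewrite -w12 mulmxDr !mulmxDl !mxtraceD.
  by rewrite opprD addrACA s10 s2 addr0.
have [d sp] : exists d, size p = d.+2.
  by exists (size p).-2; have := ip.1; case: (size p) => [|[]].
have pk1 : ev (p ^+ k) *m ev w1 = 0.
  rewrite -evM (_ : _ * w1 = b * (q * w)); last by rewrite qE /w1; ring.
  by rewrite evM [ev (q * w)]evM qw mulmx0.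
have com S (MS : M *m S = S *m M) u : ev u *m S = S *m ev u.
  exact/esym/comm_mx_horner/esym.
have Mw : M *m ev w1 = ev w1 *m M by have := evC 'X w1; rewrite evX.
have tP := trace_primary_idem PP w11 MP (com P MP w1) Mw sp mp ip pk1.
have tQ := trace_primary_idem QQ w11 MQ (com Q MQ w1) Mw sp mp ip pk1.
have tS : d.+1%:R * str (M *m ev w1) = - p`_d * str (ev w1) by rewrite !mulrBr tP tQ.
have nz : d.+1%:R * str (M *m ev w1) != 0 by rewrite mulf_neq0 // (char0_natS_neq0 charK0).
rewrite tS mulf_eq0 negb_or oppr_eq0 in nz; case/andP: nz => pd0 sw1.
(* The mean of the roots of p is not zero, so p is not X and the projector w1 is
   also given by a multiple of X. *)
have copX : coprimep 'X (p ^+ k).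
  rewrite coprimep_expr // coprimep_sym irreducible_poly_coprime //.
  apply: contra pd0 => pX.
  have : p %= 'X.
    by have [_ h] := irredp_XsubC (0 : K); rewrite subr0 in h; apply: h; rewrite ?sp.
  rewrite eqp_monic ?monicX // => /eqP pE; move: sp; rewrite pE size_polyX => -[<-].
  by rewrite coefX.
have [[u v] /= uv1] := Bezout_eq1_coprimepP _ _ copX.
have w'E : ev (u * 'X * w1) = ev w1.
  rewrite (_ : u * 'X = 1 - v * p ^+ k); last by rewrite -uv1 addrK.
  rewrite mulrBl mul1r rmorphB /= -mulrA [ev (v * _)]evM [ev (_ * w1)]evM pk1.
  by rewrite mulmx0 subr0.
by exists (u * 'X * w1); rewrite w'E; split=> //; rewrite -mulrA dvdp_mull // dvdp_mulr.
Qed.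

(** Divisibility by X is what allows the polynomial to be evaluated at an element
    of an algebra without unit. *)
Lemma exists_idempotent_poly : str M != 0 ->
  exists w, [/\ ev w *m ev w = ev w, 'X %| w & str (ev w) != 0].
Proof.
move=> sM; apply: (@idempotent_poly_step (char_poly M) 1).
- exact/monic_neq0/char_poly_monic.
- by rewrite rmorph1 mulmx1.
- by rewrite Cayley_Hamilton mul0mx.
by rewrite rmorph1 mulmx1.
Qed.

End Idempotent.
End Primary.

Section Coordinates.
Variables (K : fieldType) (W : gspace K).

Lemma lin_coord (V : lmodType K) (f : W -> V) : linear f ->
  forall v, f v = \sum_i gdual W i v *: f (gbase W i).
Proof.
move=> lf v; rewrite {1}(gbase_dual v) (lin_sum lf).
by apply: eq_bigr => i _; rewrite (linZ lf).
Qed.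

Lemma supertrace_odd (f : W -> W) :
  (forall i, homog (~~ gpar W i) (f (gbase W i))) -> supertrace f = 0.
Proof.
move=> h; apply: big1 => i _; rewrite (h i) ?mulr0 //.
by case: (gpar W i).
Qed.

End Coordinates.

Section Idempotent.
Variables (K : fieldType) (charK0 : [pchar K] =i pred0) (A : cdga K).
Local Notation "x ** y" := (cdga_mul A x y) (at level 40).
Implicit Types (x y a e : A).

Let J := gidx A.

Lemma supertrace_mul_linear : linear (fun x => supertrace (cdga_mul A x) : K^o).
Proof.
move=> c x y; rewrite /supertrace scaler_sumr -big_split; apply: eq_bigr => i _ /=.
by rewrite cdga_mul_linl linearP /GRing.scale /=; ring.
Qed.

Lemma supertrace_mul_odd x : homog true x -> supertrace (cdga_mul A x) = 0.
Proof.
move=> hx; apply: supertrace_odd => i.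
by have := cdga_mul_homog hx (@gbase_homog _ A i).
Qed.

(** du = 2 u du, and multiplying by u gives u du = 2 u du. *)
Lemma closed_idempotent e : homog false e -> e ** e = e -> dg_d A e = 0.
Proof.
move=> he ee; set d := dg_d A e.
have hd : homog true d by apply: dg_d_odd he.
have dE : d = e ** d + e ** d.
  rewrite {1}/d -{1}ee (cdga_leibniz _ he) scale1r -/d.
  by rewrite (cdga_mulC hd he) scale1r.
have e0 : e ** d = 0.
  have : e ** d = e ** (e ** d + e ** d) by rewrite -dE.
  rewrite (linD (cdga_mul_linr e)) cdga_mulA ee => /eqP.
  by rewrite -subr_eq0 opprD addNKr oppr_eq0 => /eqP.
by rewrite dE e0 addr0.
Qed.

Variables (n : nat) (cardJ : #|J| = n.+1).

Let ix (i : 'I_n.+1) : J := enum_val (cast_ord (esym cardJ) i).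
Let xi (j : J) : 'I_n.+1 := cast_ord cardJ (enum_rank j).

Let ixK : cancel ix xi.
Proof. by move=> i; rewrite /ix /xi enum_valK cast_ordKV. Qed.
Let xiK : cancel xi ix.
Proof. by move=> j; rewrite /ix /xi cast_ordK enum_rankK. Qed.

Let sum_ix (V : nmodType) (F : J -> V) : \sum_j F j = \sum_i F (ix i).
Proof. by rewrite (reindex ix) //; exists xi => ? _; rewrite ?ixK ?xiK. Qed.

Definition mul_mx x : 'M[K]_n.+1 :=
  \matrix_(i, j) gdual A (ix i) (x ** gbase A (ix j)).
Definition coord_mx x : 'cV[K]_n.+1 := \col_i gdual A (ix i) x.
Definition elt_mx (v : 'cV[K]_n.+1) : A := \sum_i v i 0 *: gbase A (ix i).
Definition par_mx (b : bool) : 'M[K]_n.+1 :=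
  diag_mx (\row_i (gpar A (ix i) == b)%:R).

Lemma coord_mxK : cancel coord_mx elt_mx.
Proof.
move=> x; rewrite [RHS](gbase_dual x) sum_ix.
by apply: eq_bigr => i _; rewrite mxE.
Qed.

Lemma elt_mxK : cancel elt_mx coord_mx.
Proof.
move=> v; apply/matrixP=> i k; rewrite (ord1 k) mxE linear_sum (bigD1 i) //=.
rewrite linearZ_LR gdual_base eqxx mulr1 big1 ?addr0 // => j ne.
by rewrite linearZ_LR gdual_base (can_eq ixK) eq_sym (negPf ne) mulr0.
Qed.

Lemma coord_mul x y : coord_mx (x ** y) = mul_mx x *m coord_mx y.
Proof.
apply/matrixP=> i k; rewrite !mxE (lin_coord (cdga_mul_linr x)) linear_sum sum_ix /=.
by apply: eq_bigr => j _; rewrite !mxE linearZ_LR mulrC.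
Qed.

Lemma mul_mxM x y : mul_mx (x ** y) = mul_mx x *m mul_mx y.
Proof.
apply/matrixP=> i k; rewrite !mxE -cdga_mulA.
have := congr1 (fun v : 'cV_n.+1 => v i 0) (coord_mul x (y ** gbase A (ix k))).
by rewrite !mxE => ->; apply: eq_bigr => j _; rewrite !mxE.
Qed.

Lemma mul_mx_linear : linear mul_mx.
Proof. by move=> c x y; apply/matrixP=> i j; rewrite !mxE cdga_mul_linl linearP. Qed.

Lemma supertraceE x : supertrace (cdga_mul A x)
  = \tr (mul_mx x *m par_mx false) - \tr (mul_mx x *m par_mx true).
Proof.
rewrite /supertrace sum_ix /mxtrace -sumrB; apply: eq_bigr => i _.
rewrite !mul_mx_diag !mxE.
by case: (gpar A (ix i)); rewrite /=; ring.
Qed.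

Lemma par_mx_idem b : par_mx b *m par_mx b = par_mx b.
Proof.
apply/matrixP=> i j; rewrite mul_diag_mx !mxE.
by case: (i == j); case: (_ == b); rewrite /= ?mulr1n ?mulr0n; ring.
Qed.

Lemma homog_coord x : homog false x <-> par_mx false *m coord_mx x = coord_mx x.
Proof.
split=> [h|/matrixP h j ne].
  apply/matrixP=> i k; rewrite mul_diag_mx !mxE; case: eqP => [_|/eqP /h ->].
    by rewrite mul1r.
  by rewrite mulr0.
by have := h (xi j) 0; rewrite mul_diag_mx !mxE xiK (negPf ne) mul0r => <-.
Qed.

Lemma mul_par_mx a b : homog false a ->
  mul_mx a *m par_mx b = par_mx b *m mul_mx a.
Proof.
move=> ha; apply/matrixP=> i j; rewrite mul_diag_mx mul_mx_diag !mxE.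
have [e|ne] := eqVneq (gpar A (ix i)) (gpar A (ix j)); first by rewrite e mulrC.
have := cdga_mul_homog ha (@gbase_homog _ A (ix j)); rewrite addFb => ->//.
by rewrite mul0r mulr0.
Qed.

(** The polynomial w is evaluated as w^2: with w = h X, the element (w h)(L) a acts
    as w(L)^2 = w(L), and it is fixed by w(L), hence idempotent. *)
Lemma even_idempotent a : homog false a -> supertrace (cdga_mul A a) != 0 ->
  exists e, [/\ homog false e, e ** e = e & supertrace (cdga_mul A e) != 0].
Proof.
move=> ha; rewrite supertraceE; set M := mul_mx a => sa.
have [w [ww Xw sw]] := exists_idempotent_poly charK0 (par_mx_idem false)
  (par_mx_idem true) (mul_par_mx false ha) (mul_par_mx true ha) sa.
pose ev q := horner_mx M q.
have evM q q' : ev (q * q') = ev q *m ev q' by rewrite /ev rmorphM.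
have [h wE] : exists h, w = h * 'X by exists (w %/ 'X); rewrite divpK.
pose e := elt_mx (ev (w * h) *m coord_mx a).
have lE q v : mul_mx (elt_mx (ev q *m v)) = ev q *m mul_mx (elt_mx v).
  have lin : linear (fun v => mul_mx (elt_mx v)).
    move=> c u u'; rewrite -mul_mx_linear; congr mul_mx; rewrite /elt_mx scaler_sumr.
    by rewrite -big_split; apply: eq_bigr => i _; rewrite !mxE scalerDl scalerA.
  elim/poly_ind: q v => [|q c IH] v.
    by rewrite /ev !rmorph0 !mul0mx (lin0 lin).
  rewrite /ev rmorphD rmorphM /= horner_mx_X horner_mx_C -/(ev q).
  rewrite -[_ * M]/(_ *m M) !mulmxDl !mul_scalar_mx (linD lin) (linZ lin) -!mulmxA IH.
  by rewrite -{1}[v]elt_mxK -coord_mul coord_mxK mul_mxM.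
have me : mul_mx e = ev w.
  rewrite /e lE coord_mxK -/M -(horner_mx_X M) -/(ev 'X) -evM -mulrA -wE evM.
  exact: ww.
exists e; split; last by rewrite supertraceE me.
  apply/homog_coord; rewrite elt_mxK mulmxA.
  have -> : par_mx false *m ev (w * h) = ev (w * h) *m par_mx false.
    exact/comm_mx_horner/esym/mul_par_mx.
  by rewrite -mulmxA; congr (_ *m _); apply/homog_coord.
rewrite -[LHS]coord_mxK coord_mul me elt_mxK mulmxA -evM mulrA evM.
by rewrite [ev (w * w)]evM ww -evM.
Qed.

End Idempotent.

Lemma closed_idempotent_exists (K : fieldType) (charK0 : [pchar K] =i pred0)
    (A : cdga K) : ~ cdga_unimodular A ->
  exists e : A, [/\ homog false e, cdga_mul A e e = e, dg_d A e = 0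
    & supertrace (cdga_mul A e) != 0].
Proof.
move=> nA; have [a sa] : exists a : A, supertrace (cdga_mul A a) != 0.
  by apply: contrapT => h; apply: nA => a; apply/eqP/negPn/negP => na; apply: h; exists a.
have [n cn] : exists n, #|gidx A| = n.+1.
  case E: #|gidx A| => [|n]; last by exists n.
  move: sa; rewrite /supertrace big1 ?eqxx // => i.
  by have := fintype0 i E.
pose part b : A := \sum_(i | gpar A i == b) gdual A i a *: gbase A i.
have hpart b : homog b (part b).
  move=> j ne; rewrite linear_sum big1 // => i /eqP pi; rewrite linearZ_LR gdual_base.
  by case: eqP => [e|_]; rewrite ?mulr0 //; move: ne; rewrite e pi eqxx.
have aE : a = part true + part false.
  rewrite {1}(gbase_dual a) (bigID (fun i => gpar A i == true)) /=; congr (_ + _).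
  by apply: eq_bigl => i; case: (gpar A i).
have sa0 : supertrace (cdga_mul A (part false)) != 0.
  move: sa; rewrite {1}aE (linD (@supertrace_mul_linear K A)).
  by rewrite supertrace_mul_odd ?add0r.
have [e [he ee se]] := even_idempotent charK0 cn (hpart false) sa0.
by exists e; split=> //; apply: closed_idempotent.
Qed.

(** * Scalar extension and restriction of word functions *)

Section LinearFields.
Variables (K : fieldType) (I : finType) (p : I -> bool).
Local Notation words := (seq I -> K^o).
Implicit Types (phi psi g : words) (i k l : I) (b c : bool).

Definition wone : words := fun w => (w == [::])%:R.

Definition letter (f : I -> K) : words :=
  fun w => if w is [:: i] then f i else 0.

Lemma wtwist_wone b : wtwist p b wone = wone.
Proof.
apply/funext=> -[|i w]; rewrite /wtwist /wone /=; first by rewrite /wpar /= andbF mul1r.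
by rewrite mulr0.
Qed.

Lemma wshift_wone i : wshift i wone = 0.
Proof. by []. Qed.

Lemma shuffle1 phi : shuffle p wone phi = phi.
Proof.
apply/funext=> w; elim: w => [|i w IH] in phi *; first by rewrite /shuffle /= mul1r.
rewrite -[LHS]/(wshift i _ w) wshift_shuffle wshift_wone wtwist_wone.
by rewrite (lin0 (shuffle_linearl p _)) add0r IH.
Qed.

Lemma wshift_letter i f : wshift i (letter f) = f i *: wone.
Proof. by apply/funext=> -[|j w]; rewrite fctE; [rewrite [RHS]mulr1|rewrite [RHS]mulr0]. Qed.

Lemma whomog_letter b f : (forall i, p i != b -> f i = 0) -> whomog p b (letter f).
Proof.
move=> h [|i [|j w]] //=; rewrite wpar_cons /wpar /= addbF; exact: h.
Qed.

Lemma whomog_shuffle b c phi psi :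
  whomog p b phi -> whomog p c psi -> whomog p (b (+) c) (shuffle p phi psi).
Proof.
move=> hb hc w; elim: w => [|i w IH] in b c phi psi hb hc *.
  rewrite /shuffle /=; case: b hb => [/(_ [::] isT)->|_]; first by rewrite mul0r.
  by case: c hc => [/(_ [::] isT)->|_] //; rewrite mulr0.
rewrite wpar_cons => ne; rewrite -[LHS]/(wshift i _ w) wshift_shuffle.
rewrite (whomog_twist _ hb) (linZ (shuffle_linearl p _)) !fctE.
rewrite (IH _ _ _ _ (whomog_shift (i := i) hb) hc); last first.
  by move: ne; case: (p i) (wpar _ _) b c {hb hc} => -[] [] [].
rewrite (IH _ _ _ _ hb (whomog_shift (i := i) hc)) ?scaler0 ?addr0 //.
by move: ne; case: (p i) (wpar _ _) b c {hb hc} => -[] [] [].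
Qed.

(** The word function of the linear vector field sum_k (sum_l D k l x_l) d/dx_k
    applied to [g]. *)
Definition lfield (D : I -> I -> K) g : words :=
  \sum_k shuffle p (letter (D k)) (wshift k g).

Lemma lfield_linear D : linear (lfield D).
Proof.
move=> c f g; rewrite /lfield scaler_sumr -big_split; apply: eq_bigr => k _ /=.
by rewrite -shuffle_linearr.
Qed.

Lemma lfield_nil D g : lfield D g [::] = 0.
Proof. by rewrite /lfield fct_sumE big1 // => k _; rewrite /shuffle /= mul0r. Qed.

Lemma wshift_lfield D g l : (forall k l, p l != ~~ p k -> D k l = 0) -> wsym p g ->
  wshift l (lfield D g)
  = \sum_k D k l *: wshift k g + (-1) ^+ p l *: lfield D (wshift l g).
Proof.
move=> oD sg; rewrite wshift_sum scaler_sumr -big_split; apply: eq_bigr => k _ /=.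
rewrite wshift_shuffle wshift_letter (linZ (shuffle_linearl p _)) shuffle1.
rewrite (whomog_twist _ (whomog_letter (oD k))) (linZ (shuffle_linearl p _)).
have -> : wshift l (wshift k g) = (-1) ^+ (p k && p l) *: wshift k (wshift l g).
  by apply/funext=> w; apply: (sg [::]).
rewrite (linZ (shuffle_linearr p _)) scalerA; congr (_ + _ *: _).
by case: (p k) (p l) => -[] /=; ring.
Qed.

End LinearFields.

Section Hadamard.
Variables (K : fieldType) (J I : finType) (a : J -> bool) (v : I -> bool).
Variables (q : J * I -> bool) (qE : forall j i, q (j, i) = a j (+) v i).

Local Notation Jwords := (seq J -> K^o).
Local Notation Iwords := (seq I -> K^o).
Local Notation words := (seq (J * I) -> K^o).
Implicit Types (lam mu nu : Jwords) (phi psi : Iwords) (G H : words).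
Implicit Types (b c : bool) (i : I) (j : J) (W : seq (J * I)).

(** The parity of sum_(r < s) |a_r| |v_s| for a word of pairs (a_r, v_r): the sign of
    moving the letters in J behind those in I.  The signs between letters in J
    belong to the function of the word in J. *)
Fixpoint hsign W : bool :=
  if W is x :: W' then (a x.1 && wpar v (map snd W')) (+) hsign W' else false.

(** The symmetrization of the series whose A-valued scalars, extended from [phi],
    have been evaluated by [lam]. *)
Definition had lam phi : words :=
  fun W => (-1) ^+ hsign W * (lam (map fst W) * phi (map snd W)).

Lemma had_linearl phi : linear (had^~ phi).
Proof.
move=> x lam mu; apply/funext=> W; rewrite /had !fctE /GRing.scale /=; ring.
Qed.

Lemma had_linearr lam : linear (had lam).
Proof.
move=> x phi psi; apply/funext=> W; rewrite /had !fctE /GRing.scale /=; ring.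
Qed.

Lemma wpar_pairs W : wpar q W = wpar a (map fst W) (+) wpar v (map snd W).
Proof.
elim: W => // -[j i] W IH; rewrite /= !wpar_cons IH qE /=.
exact: addbACA.
Qed.

Lemma wshift_had b lam phi j i : whomog v b phi ->
  wshift (j, i) (had lam phi)
  = (-1) ^+ (a j && (b (+) v i)) *: had (wshift j lam) (wshift i phi).
Proof.
move=> h; apply/funext=> W; rewrite fctE /wshift /had /= /GRing.scale /=.
have [e|ne] := eqVneq (wpar v (map snd W)) (b (+) v i).
  by rewrite e signr_addb; ring.
by rewrite (whomog_shift (i := i) h ne : phi (i :: _) = 0) !mulr0.
Qed.

Lemma wtwist_had b lam phi :
  wtwist q b (had lam phi) = had (wtwist a b lam) (wtwist v b phi).
Proof.
apply/funext=> W; rewrite /had /wtwist wpar_pairs andb_addr signr_addb; ring.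
Qed.

Lemma whomog_had b c lam phi :
  whomog a b lam -> whomog v c phi -> whomog q (b (+) c) (had lam phi).
Proof.
move=> hb hc W; rewrite wpar_pairs /had => ne.
have [e|/hb->] := eqVneq (wpar a (map fst W)) b; last by rewrite mul0r mulr0.
by rewrite hc ?mulr0 //; apply: contraNneq ne => ->; rewrite e.
Qed.

(** Exchanging the neighbours (j, i) and (j', i') changes [hsign] by the mixed terms
    |j| |i'| + |j'| |i| of their Koszul sign, and the two factors by the others. *)
Lemma wsym_had lam phi : wsym a lam -> wsym v phi -> wsym q (had lam phi).
Proof.
move=> hl hp W [j i] [j' i'] W'; rewrite /had !map_cat /= hl hp !qE.
suff -> : hsign (W ++ (j, i) :: (j', i') :: W')
  = hsign (W ++ (j', i') :: (j, i) :: W') (+) (a j && v i') (+) (a j' && v i).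
  rewrite !signr_addb.
  by case: (a j) (a j') (v i) (v i') => -[] [] [] /=; ring.
elim: W => [|x W IH] /=.
  rewrite !wpar_cons.
  by case: (a j) (a j') (v i) (v i') (wpar v _) (hsign W') => -[] [] [] [] [].
rewrite IH !map_cat !wpar_cat /= !wpar_cons !addbA; congr (_ (+) _ (+) _ (+) _).
by congr (_ && _); case: (v i) (v i') (wpar v _) => -[] [].
Qed.

(** The functions [lam r], [mu r] on words in J play the role of the scalars of a
    product f g of two A-valued series: summing over r recombines them into the
    function [nu] of the concatenated word.  The sign in the hypothesis is that
    of moving the scalars of f past g. *)
Lemma had_shuffle (T : finType) (lam mu : T -> Jwords) nu phi psi b c :
  whomog v b phi -> whomog v c psi -> wsym a nu ->
  (forall s s' w, size w = size s ->
     (\sum_r lam r s * mu r s') * phi w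
     = (-1) ^+ (wpar a s && c) * nu (s ++ s') * phi w) ->
  \sum_r shuffle q (had (lam r) phi) (had (mu r) psi) = had nu (shuffle v phi psi).
Proof.
move=> hb hc sn h; apply/funext=> W; rewrite fct_sumE.
elim: W => [|[j i] W IH] in lam mu nu phi psi b c hb hc sn h *.
  have := h [::] [::] [::] erefl; rewrite /shuffle /had /= expr0 mul1r => e.
  rewrite mul1r mulrA -e mulr_suml mulr_suml; apply: eq_bigr => r _.
  by rewrite !mul1r; ring.
pose s1 : K := (-1) ^+ (a j && (b (+) v i)).
pose s2 : K := (-1) ^+ (q (j, i) && b) * (-1) ^+ (a j && (c (+) v i)).
pose lam1 r := wshift j (lam r); pose lam2 r := wtwist a (q (j, i)) (lam r).
pose mu2 r := wshift j (mu r).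
transitivity (s1 * (\sum_r shuffle q (had (lam1 r) (wshift i phi)) (had (mu r) psi) W)
  + s2 * (\sum_r shuffle q (had (lam2 r) phi) (had (mu2 r) (wshift i psi)) W)).
  rewrite !mulr_sumr -big_split; apply: eq_bigr => r _ /=.
  rewrite [LHS]/= wtwist_had (whomog_twist _ hb).
  rewrite (wshift_had _ _ _ hb) (wshift_had _ _ _ hc) (linZ (had_linearr _)).
  rewrite !(linZ (shuffle_linearl q _)) (linZ (shuffle_linearr q _)) scalerA.
  by [].
rewrite (IH lam1 mu ((-1) ^+ (a j && c) *: wshift j nu) (wshift i phi) psi (b (+) v i) c);
  first last.
- move=> s s' w sw; rewrite (h (j :: s) s' (i :: w)) /= ?sw // wpar_cons andb_addl signr_addb.
  by rewrite fctE /wshift /GRing.scale /=; ring.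
- move=> w k k' w'; rewrite !fctE (wsym_shift j sn) /GRing.scale /=; ring.
- exact: hc.
- exact: whomog_shift.
rewrite (IH lam2 mu2 (wshift j nu) phi (wshift i psi) b (c (+) v i)); first last.
- move=> s s' w sw.
  transitivity ((-1) ^+ (q (j, i) && wpar a s) * ((\sum_r lam r s * mu r (j :: s')) * phi w)).
    rewrite mulrA; congr (_ * _); rewrite mulr_sumr; apply: eq_bigr => r _.
    by rewrite /lam2 /mu2 /wtwist /wshift mulrA.
  rewrite (h _ _ _ sw) (wsym_move s j s' sn) qE /wshift !mulrA; congr (_ * _ * _).
  by case: (a j) (v i) (wpar a s) c {h hc s1 s2} => -[] [] [] /=; ring.
- exact: wsym_shift.
- exact: whomog_shift.
- exact: hb.
rewrite -[RHS]/(wshift (j, i) _ W) (wshift_had _ _ _ (whomog_shuffle hb hc)).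
rewrite wshift_shuffle (whomog_twist _ hb) (linZ (shuffle_linearl v _)).
rewrite (linD (had_linearr _)) (linZ (had_linearr _)) (linZ (had_linearl _)) !fctE.
rewrite /GRing.scale /= mulrDr !mulrA; congr (_ * _ + _ * _); rewrite /s1 /s2 ?qE.
  by case: (a j) (v i) b c {h hb hc s1 s2} => -[] [] [] /=; ring.
by case: (a j) (v i) b c {h hb hc s1 s2} => -[] [] [] /=; ring.
Qed.

(** The differential of A acts on the coordinates of A (x) V by the linear vector
    field on the left; it only sees the scalars.  Removing the first letter either
    differentiates it or differentiates the rest, on both sides. *)
Lemma lfield_had (D : J -> J -> K) lam phi b :
  (forall j k, a k != ~~ a j -> D j k = 0) ->
  wsym a lam -> wsym v phi -> whomog v b phi ->
  lfield q (fun x y => (-1) ^+ v x.2 * D x.1 y.1 * (x.2 == y.2)%:R) (had lam phi)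
  = (-1) ^+ b *: had (lfield a D lam) phi.
Proof.
move=> oD sl sp hb; set Dq := fun x y => _.
have oDq x y : q y != ~~ q x -> Dq x y = 0.
  case: x y => [j i] [k l]; rewrite !qE /Dq /=.
  have [<-|ne] := eqVneq i l; last by rewrite mulr0.
  move=> ne; rewrite oD ?mulr0 ?mul0r //.
  by move: ne; case: (a j) (a k) (v i) => -[] [].
apply/funext=> W; elim: W => [|[j i] W IH] in lam phi b sl sp hb *.
  by rewrite lfield_nil fctE /had /= lfield_nil mul0r !mulr0 scaler0.
have sumE : (\sum_k Dq k (j, i) *: wshift k (had lam phi)) W
  = \sum_k (-1) ^+ v i * D k j * ((-1) ^+ (a k && (b (+) v i))
       * had (wshift k lam) (wshift i phi) W).
  rewrite fct_sumE (eq_bigr (fun k : J * I => (k.2 == i)%:R * ((-1) ^+ v i * D k.1 j *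
      ((-1) ^+ (a k.1 && (b (+) v i)) * had (wshift k.1 lam) (wshift i phi) W)))); last first.
    move=> [k l] _ /=; rewrite (wshift_had _ _ _ hb) fctE /Dq /= /GRing.scale /=.
    by case: eqP => [->|_]; rewrite ?mulr0 ?mul0r // mulr1 mul1r.
  rewrite -(pair_bigA _ (fun k l => (l == i)%:R * ((-1) ^+ v i * D k j *
      ((-1) ^+ (a k && (b (+) v i)) * had (wshift k lam) (wshift i phi) W)))) /=.
  apply: eq_bigr => k _; rewrite (bigD1 i) //= eqxx mul1r big1 ?addr0 // => l /negPf->.
  by rewrite mul0r.
rewrite -[LHS]/(wshift (j, i) _ W) wshift_lfield //; last exact: wsym_had.
rewrite fctE sumE -[RHS]/((-1) ^+ b * wshift (j, i) (had _ _) W) (wshift_had _ _ _ hb).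
rewrite (wshift_had _ _ _ hb) (linZ (@lfield_linear _ _ _ _)) !fctE.
rewrite (IH _ _ (b (+) v i)); [|exact: wsym_shift|exact: wsym_shift|exact: whomog_shift].
rewrite wshift_lfield // (linD (had_linearl _)) (linZ (had_linearl _)) !fctE.
rewrite /GRing.scale /= !mulrDr; congr (_ + _); last first.
  by rewrite qE; case: (a j) (v i) b {hb sumE} => -[] [] /=; ring.
rewrite {2}/had fct_sumE mulr_suml !mulr_sumr; apply: eq_bigr => k _.
rewrite -[_ * (_ * phi _)]/(had (D k j *: wshift k lam) (wshift i phi) W).
rewrite (linZ (had_linearl _)) fctE /GRing.scale /=.
have [e|/oD->] := eqVneq (a j) (~~ a k); last by ring.
by rewrite e; case: (a k) (v i) b {hb sumE} => -[] [] /=; ring.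
Qed.

Section Restriction.
Variables (ep : J -> K) (ep_even : forall j, a j -> ep j = 0).

Definition jshift lam : Jwords := \sum_j ep j *: wshift j lam.

Definition ishift i G : words := \sum_j ep j *: wshift (j, i) G.

Fixpoint restrict_at w G : K :=
  if w is i :: w' then restrict_at w' (ishift i G) else G [::].

(** The multilinear function [G] restricted to the arguments u (x) e_i, where
    u is the even vector with coordinates [ep]. *)
Definition wrestrict G : Iwords := fun w => restrict_at w G.

Lemma ishift_linear i : linear (ishift i).
Proof.
move=> x G H; rewrite /ishift scaler_sumr -big_split; apply: eq_bigr => j _ /=.
by rewrite [wshift _ _](_ : _ = x *: wshift (j, i) G + wshift (j, i) H) // scalerDr !scalerA mulrC.
Qed.

Lemma restrict_linear : linear wrestrict.
Proof.
move=> x G H; apply/funext=> w.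
change (restrict_at w (x *: G + H) = x * restrict_at w G + restrict_at w H).
by elim: w => [|i w IH] in G H * => //=; rewrite ishift_linear IH.
Qed.

Lemma wshift_restrict i G : wshift i (wrestrict G) = wrestrict (ishift i G).
Proof. by []. Qed.

Lemma ep_parity j i : ep j != 0 -> q (j, i) = v i.
Proof. by rewrite qE; case aj: (a j) => //=; rewrite ep_even ?aj // eqxx. Qed.

Lemma ishift_twist b i G :
  ishift i (wtwist q b G) = (-1) ^+ (b && v i) *: wtwist q b (ishift i G).
Proof.
rewrite /ishift (lin_sum (wtwist_linear q b)) scaler_sumr; apply: eq_bigr => j _.
have [->|/(ep_parity i) e] := eqVneq (ep j) 0.
  by rewrite !scale0r (lin0 (wtwist_linear q b)) scaler0.
by rewrite wshift_twist e (linZ (wtwist_linear q b)) !scalerA mulrC.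
Qed.

Lemma restrict_twist b G : wrestrict (wtwist q b G) = wtwist v b (wrestrict G).
Proof.
apply/funext=> w; elim: w => [|i w IH] in G *.
  by rewrite /wtwist /wrestrict /= /wtwist.
rewrite -[LHS]/(wrestrict (ishift i _) w) ishift_twist (linZ restrict_linear) fctE IH.
by rewrite -[RHS]/(wshift i _ w) wshift_twist.
Qed.

(** Restriction to an even vector u replaces x_(j,i) by the scalar multiple
    u_j x_i, which is a morphism of graded algebras. *)
Lemma restrict_shuffle G H :
  wrestrict (shuffle q G H) = shuffle v (wrestrict G) (wrestrict H).
Proof.
apply/funext=> w; elim: w => [//|i w IH] in G H *.
rewrite -[LHS]/(wrestrict (ishift i _) w) -[RHS]/(wshift i _ w) wshift_shuffle.
rewrite !wshift_restrict -restrict_twist fctE -!IH.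
rewrite -[RHS]/((wrestrict _ + wrestrict _) w) -(linD restrict_linear); congr (wrestrict _ w).
rewrite /ishift (lin_sum (shuffle_linearl q _)) (lin_sum (shuffle_linearr q _)).
rewrite -big_split; apply: eq_bigr => j _ /=.
have [->|/(ep_parity i) e] := eqVneq (ep j) 0.
  by rewrite !scale0r (lin0 (shuffle_linearl q _)) (lin0 (shuffle_linearr q _)) addr0.
rewrite wshift_shuffle e scalerDr.
by rewrite (linZ (shuffle_linearl q _)) (linZ (shuffle_linearr q _)).
Qed.

Lemma restrict_homog b G : whomog q b G -> whomog v b (wrestrict G).
Proof.
move=> h w; elim: w => [|i w IH] in b G h *; first by move=> ne; apply: h.
rewrite wpar_cons => ne; apply: (IH (b (+) v i)); last first.
  by move: ne; case: (v i) (wpar _ _) b {h IH} => -[] [].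
move=> W nW; rewrite /ishift fct_sumE big1 // => j _; rewrite fctE.
have [->|/(ep_parity i) e] := eqVneq (ep j) 0; first by rewrite scale0r.
by rewrite (whomog_shift (i := (j, i)) h) ?scaler0 // e.
Qed.

Lemma ishiftC i i' G : wsym q G ->
  ishift i' (ishift i G) = (-1) ^+ (v i && v i') *: ishift i (ishift i' G).
Proof.
move=> sG; rewrite /ishift.
under eq_bigr do rewrite wshift_sum scaler_sumr.
rewrite exchange_big scaler_sumr; apply: eq_bigr => j _ /=.
rewrite wshift_sum !scaler_sumr; apply: eq_bigr => j' _.
have [->|/(ep_parity i) e] := eqVneq (ep j) 0.
  by rewrite !(wshiftZ, scale0r, scaler0).
have [->|/(ep_parity i') e'] := eqVneq (ep j') 0.
  by rewrite !(wshiftZ, scale0r, scaler0).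
apply/funext=> W; have /= := sG [::] (j, i) (j', i') W; rewrite e e' => sE.
rewrite -[LHS]/(ep j' * (ep j * G [:: (j, i), (j', i') & W])) sE.
by rewrite -[RHS]/(_ * (ep j * (ep j' * G [:: (j', i'), (j, i) & W]))); ring.
Qed.

Lemma ishift_sym i G : wsym q G -> wsym q (ishift i G).
Proof.
move=> sG W k k' W'; rewrite /ishift !fct_sumE mulr_sumr; apply: eq_bigr => j _.
by rewrite !fctE (wsym_shift (j, i) sG) /GRing.scale /=; ring.
Qed.

Lemma restrict_sym G : wsym q G -> wsym v (wrestrict G).
Proof.
move=> sG w i i' w'; elim: w => [|k w IH] in G sG *.
  change (wrestrict (ishift i' (ishift i G)) w' = (-1) ^+ (v i && v i')
    * wrestrict (ishift i (ishift i' G)) w').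
  by rewrite (ishiftC _ _ sG) (linZ restrict_linear).
by apply: (IH (ishift k G)); apply: ishift_sym.
Qed.

(** At u (x) e_i1, ..., u (x) e_in all letters in J are even, so no sign is left and
    [lam] is evaluated at (u, ..., u). *)
Lemma restrict_had lam phi w :
  wrestrict (had lam phi) w = iter (size w) jshift lam [::] * phi w.
Proof.
elim: w => [|i w IH] in lam phi *; first by rewrite /wrestrict /had /= expr0 mul1r.
rewrite -[LHS]/(wrestrict (ishift i _) w) iterSr -[phi _]/(wshift i phi w) -IH.
congr (wrestrict _ w); rewrite /ishift /jshift; apply/funext=> W.
rewrite /had !fct_sumE mulr_suml mulr_sumr; apply: eq_bigr => j _.
rewrite !fctE /GRing.scale /= /wshift /had /=.
case aj: (a j); last by rewrite /=; ring.
by rewrite ep_even ?aj //; ring.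
Qed.

End Restriction.
End Hadamard.

(** * Words in the algebra A *)

Section WordSign.
Variables (K : fieldType) (I : finType) (p : I -> bool).

Lemma word_sign_cons i w :
  word_sign K p (i :: w) = (-1) ^+ (p i && wpar p w) * word_sign K p w.
Proof.
rewrite /word_sign /= -exprD; apply: eq_sign.
by case: (p i); rewrite /wpar /= ?add0n // add1n binS bin1 !oddD oddb addbC.
Qed.

Lemma word_sign_cat w w' : word_sign K p (w ++ w')
  = (-1) ^+ (wpar p w && wpar p w') * word_sign K p w * word_sign K p w'.
Proof.
elim: w => [|i w IH]; first by rewrite /word_sign /= expr0 !mul1r.
rewrite /= !word_sign_cons IH wpar_cat wpar_cons.
by case: (p i) (wpar p w) (wpar p w') => -[] [] /=; ring.
Qed.

End WordSign.

Section AlgebraWords.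
Variables (K : fieldType) (A : cdga K).
Local Notation "x ** y" := (cdga_mul A x y) (at level 40).
Local Notation J := (gidx A).
Local Notation a := (gpar A).
Local Notation e_ := (gbase A).
Local Notation words := (seq J -> K^o).
Implicit Types (x y : A) (s w : seq J) (j k : J) (b c : bool) (ell : A -> K^o).

Definition rprod x s : A := foldl (fun x j => x ** e_ j) x s.

Lemma rprod_linear s : linear (rprod^~ s).
Proof.
elim: s => [//|j s IH] z x y; rewrite -IH /rprod /=.
by rewrite cdga_mul_linl.
Qed.

Lemma rprod_cat x s s' : rprod x (s ++ s') = rprod (rprod x s) s'.
Proof. exact: foldl_cat. Qed.

Lemma rprodA x y s : rprod (x ** y) s = x ** rprod y s.
Proof. by elim: s y => [//|j s IH] y; rewrite /rprod /= -cdga_mulA; apply: IH. Qed.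

Lemma aprod_cons j s : aprod (A := A) (j :: s) = rprod (e_ j) s.
Proof. by []. Qed.

Lemma aprod_cons_mul j s : s != [::] -> aprod (A := A) (j :: s) = e_ j ** aprod s.
Proof. by case: s => // k s _; rewrite !aprod_cons -rprodA. Qed.

Lemma homog_rprod b x s : homog b x -> homog (b (+) wpar a s) (rprod x s).
Proof.
elim: s b x => [|j s IH] b x h; first by rewrite addbF.
by rewrite wpar_cons addbA; apply: IH; apply: cdga_mul_homog h (@gbase_homog _ A j).
Qed.

Lemma homog_aprod s : homog (wpar a s) (aprod (A := A) s).
Proof.
case: s => [|j s]; first by move=> i _; rewrite linear0.
by rewrite wpar_cons aprod_cons; apply: homog_rprod; apply: gbase_homog.
Qed.

(** Multilinear functions of s with the product [x s] evaluated by [ell].  The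
    factor [word_sign] passes from multilinear functions on A to symmetrizations. *)
Definition prefix_word ell x : words := fun s => word_sign K a s * ell (rprod x s).

(** The variant without prefix; as A may have no unit, it is not an instance of
    [prefix_word]. *)
Definition alg_word ell : words := fun s => word_sign K a s * ell (aprod s).

Lemma word_sign_swap s i j s' :
  word_sign K a (s ++ i :: j :: s') = word_sign K a (s ++ j :: i :: s').
Proof. by rewrite /word_sign !count_cat /= [(a i + _)%N]addnCA. Qed.

Lemma rprod_swap x s i j s' : rprod x (s ++ i :: j :: s')
  = (-1) ^+ (a i && a j) *: rprod x (s ++ j :: i :: s').
Proof.
rewrite !rprod_cat /rprod /= -!/(rprod _ _) -!cdga_mulA.
rewrite (cdga_mulC (@gbase_homog _ A i) (@gbase_homog _ A j)).
by rewrite (linZ (cdga_mul_linr _)) (linZ (rprod_linear s')).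
Qed.

Lemma prefix_word_sym ell x : linear ell -> wsym a (prefix_word ell x).
Proof.
move=> le s i j s'; rewrite /prefix_word word_sign_swap rprod_swap (linZ le).
exact: mulrCA.
Qed.

Lemma alg_word_sym ell : linear ell -> wsym a (alg_word ell).
Proof.
move=> le [|k s] i j s'; last first.
  rewrite /alg_word (word_sign_swap (k :: s)) !cat_cons !aprod_cons rprod_swap (linZ le).
  exact: mulrCA.
rewrite /alg_word (word_sign_swap [::]) !aprod_cons /rprod /= -!/(rprod _ _).
rewrite (cdga_mulC (@gbase_homog _ A i) (@gbase_homog _ A j)).
rewrite (linZ (rprod_linear s')) (linZ le); exact: mulrCA.
Qed.

Lemma prefix_word_linear ell : linear ell -> linear (prefix_word ell).
Proof.
move=> le z x y; apply/funext=> s; rewrite !fctE /prefix_word rprod_linear le.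
by rewrite /GRing.scale /=; ring.
Qed.

Definition coord_word j : words := alg_word (gdual A j).

Definition mul_trace x : K^o := supertrace (cdga_mul A x).

Definition trace_word : words := alg_word mul_trace.

Lemma mul_trace_linear : linear mul_trace.
Proof. exact: supertrace_mul_linear. Qed.

Lemma gdual_linear j : linear (gdual A j : A -> K^o).
Proof. by move=> z x y; rewrite linearP. Qed.

Lemma coord_word_homog j s : wpar a s != a j -> coord_word j s = 0.
Proof.
move=> ne; rewrite /coord_word /alg_word (homog_aprod (s := s)) ?mulr0 //.
by rewrite eq_sym.
Qed.

Lemma coord_word1 j k : coord_word j [:: k] = (j == k)%:R.
Proof. by rewrite /coord_word /alg_word /word_sign /= addn0 gdual_base; case: (a k); rewrite mul1r. Qed.

Lemma trace_word_homog : whomog a false trace_word.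
Proof.
move=> s; case es: (wpar a s) => // _; rewrite /trace_word /alg_word /mul_trace.
by rewrite supertrace_mul_odd ?mulr0 //; rewrite -es; apply: homog_aprod.
Qed.

(** Expanding the product of the first word in the basis and multiplying by the
    second word. *)
Lemma trace_word_cat s s' : s != [::] ->
  \sum_j coord_word j s * trace_word (j :: s') = trace_word (s ++ s').
Proof.
move=> s0.
have rE : mul_trace (aprod (s ++ s')) = \sum_j gdual A j (aprod s) * mul_trace (aprod (j :: s')).
  have lin : linear (fun x => mul_trace (rprod x s')).
    by move=> z x y; rewrite rprod_linear mul_trace_linear.
  rewrite -[RHS](lin_coord lin); congr mul_trace.
  by case: s s0 => // j s _; rewrite cat_cons !aprod_cons rprod_cat.
rewrite [RHS]/trace_word /alg_word rE word_sign_cat mulr_sumr; apply: eq_bigr => j _.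
have [e|ne] := eqVneq (wpar a s) (a j); last first.
  rewrite coord_word_homog // (homog_aprod (s := s)) 1?eq_sym //; ring.
rewrite /coord_word /trace_word /alg_word word_sign_cons e; ring.
Qed.

(** Contracting the output of the multiplication with one of its inputs gives its
    trace; the Koszul sign of that exchange is absorbed by [word_sign]. *)
Lemma trace_word_contract s : s != [::] ->
  \sum_j (-1) ^+ a j * coord_word j (j :: s) = trace_word s.
Proof.
move=> s0; rewrite /trace_word /alg_word /mul_trace /supertrace mulr_sumr.
apply: eq_bigr => j _; rewrite /coord_word /alg_word word_sign_cons aprod_cons_mul //.
rewrite (cdga_mulC (@gbase_homog _ A j) (@homog_aprod s)) linearZ_LR /=.
by case: (a j) (wpar a s) => -[] /=; ring.
Qed.

(** Multiplication by dx is the graded commutator of d and multiplication by x, and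
    supertraces vanish on graded commutators. *)
Lemma mul_trace_d b x : homog b x -> mul_trace (dg_d A x) = 0.
Proof.
move=> hx; have hd := dg_d_odd hx; case: b hx hd => hx hd; last by rewrite /mul_trace supertrace_mul_odd.
pose d i k := gdual A i (dg_d A (e_ k)); pose L i k := gdual A i (x ** e_ k).
have dL i : gdual A i (dg_d A (x ** e_ i)) = \sum_k L k i * d i k.
  rewrite [in LHS](gbase_dual (x ** e_ i)) !linear_sum; apply: eq_bigr => k _.
  by rewrite !linearZ_LR.
have Ld i : gdual A i (x ** dg_d A (e_ i)) = \sum_k d k i * L i k.
  rewrite [in LHS](gbase_dual (dg_d A (e_ i))) (lin_sum (cdga_mul_linr _)) linear_sum.
  by apply: eq_bigr => k _; rewrite (linZ (cdga_mul_linr _)) linearZ_LR.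
rewrite /mul_trace /supertrace.
transitivity (\sum_i (-1) ^+ a i * (\sum_k L k i * d i k + \sum_k d k i * L i k)).
  apply: eq_bigr => i _; congr (_ * _).
  have := congr1 (gdual A i) (cdga_leibniz (e_ i) hx).
  by rewrite linearD linearZ_LR /= -dL -Ld => ->; ring.
under eq_bigr do rewrite mulrDr !mulr_sumr.
rewrite big_split /= [X in X + _]exchange_big /= -big_split big1 // => i _ /=.
rewrite -big_split big1 // => k _ /=.
have [e|ne] := eqVneq (a k) (~~ a i).
  by rewrite e; case: (a i); rewrite /=; ring.
have := dg_d_odd (@gbase_homog _ A i) => h.
by rewrite /d (h k ne); ring.
Qed.

Local Notation dmat := (fun j k => (-1) ^+ a j * gdual A j (dg_d A (e_ k))).

Lemma dmat_odd j k : a k != ~~ a j -> dmat j k = 0 :> K.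
Proof.
move=> ne /=; rewrite (dg_d_odd (@gbase_homog _ A k)) ?mulr0 //.
by move: ne; case: (a j) (a k) => -[].
Qed.

Lemma wshift_prefix_word b x j : homog b x ->
  wshift j (prefix_word mul_trace x)
  = (-1) ^+ (a j && (b (+) a j)) *: prefix_word mul_trace (x ** e_ j).
Proof.
move=> hx; apply/funext=> s; rewrite fctE /wshift /prefix_word word_sign_cons /=.
have [->|ne] := eqVneq (wpar a s) (b (+) a j); first by rewrite /GRing.scale /= mulrA.
rewrite /mul_trace supertrace_mul_odd ?mulr0 ?scaler0 //.
have := homog_rprod (s := s) (cdga_mul_homog hx (@gbase_homog _ A j)).
by move: ne; case: (b (+) a j) (wpar a s) => -[].
Qed.

(** Applying the differential to one letter at a time amounts, by the Leibniz
    rule and because the trace vanishes on exact elements, to applying it to the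
    prefix. *)
Lemma lfield_prefix_word b x : homog b x ->
  lfield a dmat (prefix_word mul_trace x) = - prefix_word mul_trace (dg_d A x).
Proof.
move=> hx; apply/funext=> s; elim: s => [|j s IH] in b x hx *.
  rewrite lfield_nil -[RHS]/(- prefix_word mul_trace (dg_d A x) [::]) /prefix_word /=.
  by rewrite (mul_trace_d hx) mulr0 oppr0.
have psym := prefix_word_sym x mul_trace_linear.
rewrite -[LHS]/(wshift j _ s) (wshift_lfield _ dmat_odd psym) fctE.
rewrite -[RHS]/(- wshift j (prefix_word mul_trace (dg_d A x)) s).
rewrite (wshift_prefix_word _ (dg_d_odd hx)) (wshift_prefix_word _ hx).
rewrite (linZ (@lfield_linear _ _ _ _)) !fctE.
rewrite (IH _ _ (cdga_mul_homog hx (@gbase_homog _ A j))) (cdga_leibniz _ hx).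
rewrite (linD (prefix_word_linear mul_trace_linear)) (linZ (prefix_word_linear mul_trace_linear)).
have -> : (\sum_k (-1) ^+ a k * gdual A k (dg_d A (e_ j)) *:
    wshift k (prefix_word mul_trace x)) s
    = (-1) ^+ (~~ a j && b) * prefix_word mul_trace (x ** dg_d A (e_ j)) s.
  rewrite [in RHS](gbase_dual (dg_d A (e_ j))) (lin_sum (cdga_mul_linr _)).
  rewrite (lin_sum (prefix_word_linear mul_trace_linear)) !fct_sumE mulr_sumr.
  apply: eq_bigr => k _; rewrite (wshift_prefix_word _ hx) (linZ (cdga_mul_linr _)).
  rewrite (linZ (prefix_word_linear mul_trace_linear)) !fctE /GRing.scale /=.
  have [e|ne] := eqVneq (a k) (~~ a j).
    by rewrite e; case: (a j) b {hx IH} => -[] /=; ring.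
  by rewrite (dg_d_odd (@gbase_homog _ A j) ne); ring.
rewrite -[(- _) s]/(- (_ + _ * _)) /GRing.scale /=.
by case: (a j) b {hx IH} => -[] /=; ring.
Qed.

(** By the Leibniz rule the differentials of the letters add up to that of the
    product, on which t vanishes. *)
Lemma lfield_trace_word : lfield a dmat trace_word = 0.
Proof.
apply: wordsP => [|j]; first exact: lfield_nil.
have wE k : wshift k trace_word = (-1) ^+ a k *: prefix_word mul_trace (e_ k).
  apply/funext=> s; rewrite fctE /wshift /trace_word /alg_word aprod_cons word_sign_cons.
  rewrite /prefix_word /GRing.scale /=.
  have [->|ne] := eqVneq (wpar a s) (a k); first by rewrite andbb mulrA.
  rewrite /mul_trace supertrace_mul_odd ?mulr0 //.
  have := homog_rprod (s := s) (@gbase_homog _ A k).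
  by move: ne; case: (a k) (wpar a s) => -[].
rewrite (wshift_lfield _ dmat_odd (alg_word_sym mul_trace_linear)).
rewrite !wE (linZ (@lfield_linear _ _ _ _)) (lfield_prefix_word (@gbase_homog _ A j)).
rewrite scalerA -signr_addb addbb scale1r.
rewrite [in X in _ - X](gbase_dual (dg_d A (e_ j))).
rewrite (lin_sum (prefix_word_linear mul_trace_linear)) -sumrB big1 // => k _.
rewrite wE (linZ (prefix_word_linear mul_trace_linear)) scalerA mulrAC.
by rewrite -signr_addb addbb mul1r subrr.
Qed.

Section AtIdempotent.
Variables (u : A) (hu : homog false u) (uu : u ** u = u).

Lemma even_coord j : a j -> gdual A j u = 0.
Proof. by move=> aj; apply: hu; rewrite aj. Qed.

(** A product of copies of the idempotent u is u, whatever their number. *)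
Lemma iter_jshift ell n : linear ell ->
  iter n.+1 (jshift (fun j => gdual A j u)) (alg_word ell) [::] = ell u.
Proof.
move=> le; set sh := jshift _.
have shE x : sh (prefix_word ell x) = prefix_word ell (x ** u).
  rewrite [in RHS](gbase_dual u) (lin_sum (cdga_mul_linr _)).
  rewrite (lin_sum (prefix_word_linear le)); apply: eq_bigr => j _.
  rewrite (linZ (cdga_mul_linr _)) (linZ (prefix_word_linear le)).
  apply/funext=> s; rewrite !fctE /wshift /prefix_word word_sign_cons.
  by case aj: (a j); [rewrite even_coord ?scale0r|rewrite mul1r].
have sh1 : sh (alg_word ell) = prefix_word ell u.
  rewrite [in RHS](gbase_dual u).
  rewrite (lin_sum (prefix_word_linear le)); apply: eq_bigr => j _.
  rewrite (linZ (prefix_word_linear le)).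
  apply/funext=> s; rewrite !fctE /wshift /prefix_word /alg_word word_sign_cons.
  by case aj: (a j); [rewrite even_coord ?scale0r|rewrite mul1r].
rewrite iterSr sh1; have -> : iter n sh (prefix_word ell u) = prefix_word ell u.
  by elim: n => //= n ->; rewrite shE uu.
by rewrite /prefix_word /word_sign /= expr0 mul1r.
Qed.

End AtIdempotent.
End AlgebraWords.

(** * The tensor product structure *)

Section VectorFields.
Variables (K : fieldType) (charK0 : [pchar K] =i pred0).
Variables (I : finType) (p : I -> bool).
Local Notation words := (seq I -> K^o).
Local Notation series := (series K p).
Local Notation sym := (@symmetrization K I p).
Implicit Types (f g : series) (phi : I -> words) (i k : I).

(** The vector field with components [phi i], acting on symmetrizations. *)
Definition wfield phi (G : words) : words := \sum_i shuffle p (phi i) (wshift i G).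

Lemma wfield_linear phi : linear (wfield phi).
Proof.
move=> c f g; rewrite /wfield scaler_sumr -big_split; apply: eq_bigr => k _ /=.
by rewrite -shuffle_linearr.
Qed.

Lemma sym_vfield (F : I -> series) g :
  sym (vfield F g) = wfield (fun i => sym (F i)) (sym g).
Proof.
rewrite /vfield (lin_sum (@sym_linear K I p)); apply: eq_bigr => i _.
by rewrite sym_smul sym_shift.
Qed.

Lemma sym_svar k : sym (svar K p k) = letter (fun i => (i == k)%:R).
Proof.
apply: wordsP => [|i].
  rewrite /symmetrization /= coef_svar; case: eqP => // /ffunP/(_ k).
  by rewrite !ffunE eqxx.
rewrite wshift_letter sym_shift pd_svar (linZ (@sym_linear K I p)); congr (_ *: _).
apply: wordsP => [|j]; first by rewrite /symmetrization /= coef_sone eqxx.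
by rewrite sym_shift pd_sone (lin0 (@sym_linear K I p)).
Qed.

Lemma sym_linear_field (c : I -> K) : sym (\sum_i c i *: svar K p i) = letter c.
Proof.
rewrite (lin_sum (@sym_linear K I p)); apply: wordsP => [|i].
  rewrite fct_sumE big1 // => j _; rewrite (linZ (@sym_linear K I p)) sym_svar.
  by rewrite fctE scaler0.
rewrite wshift_sum wshift_letter (bigD1 i) //= (linZ (@sym_linear K I p)) sym_svar.
rewrite wshiftZ wshift_letter eqxx scale1r big1 ?addr0 // => j ne.
rewrite (linZ (@sym_linear K I p)) sym_svar wshiftZ wshift_letter eq_sym (negPf ne).
by rewrite scale0r scaler0.
Qed.

Lemma shuffle_wone (G : words) : shuffle p G (@wone K I) = G.
Proof.
apply/funext=> w; elim: w => [|i w IH] in G *; first by rewrite /shuffle /= mulr1.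
rewrite -[LHS]/(wshift i _ w) wshift_shuffle wshift_wone.
by rewrite (lin0 (shuffle_linearr p _)) addr0 IH.
Qed.

Lemma vfield_svar (F : I -> series) k : vfield F (svar K p k) = F k.
Proof.
apply: (sym_inj charK0); rewrite sym_vfield /wfield (bigD1 k) //= big1 => [|i ne].
  by rewrite sym_svar wshift_letter eqxx scale1r shuffle_wone addr0.
rewrite sym_svar wshift_letter (negPf ne) scale0r.
exact: (lin0 (shuffle_linearr p _)).
Qed.

Lemma sym_divergence (xi : series -> series) :
  sym (divergence true xi) = \sum_i wshift i (sym (xi (svar K p i))).
Proof.
rewrite /divergence (lin_sum (@sym_linear K I p)); apply: eq_bigr => i _.
by rewrite addTb andNb scale1r.
Qed.

(** The form in which the series of a family of multilinear maps is given by
    [of_mult]. *)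
Lemma serE (c : words) (a : monom p) : @ser K I p c a =
  ((mlen (val a))`!%:R)^-1 * \sum_(w : (mlen (val a)).-tuple I) c w * sword K p w a.
Proof. by rewrite /ser hsum_tuple fct_sumE. Qed.

End VectorFields.

Section Tensor.
Variables (K : fieldType) (charK0 : [pchar K] =i pred0).
Variables (A : cdga K) (V : dgspace K) (m : Sym V -> Sym V).
Hypotheses (dm : is_derivation true m) (m2 : der_ge 2 m).

Local Notation J := (gidx A).
Local Notation I := (gidx (Pi V)).
Local Notation a := (gpar A).
Local Notation v := (gpar (Pi V)).
Local Notation T := (tensor A V).
Local Notation q := (gpar (Pi T)).
Local Notation symV := (@symmetrization K I v).
Local Notation symT := (@symmetrization K (gidx (Pi T)) q).
Local Notation mT := (tensor_Linfty A m).
Local Notation hadA := (@had K J I a v).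
Local Notation Iwords := (seq I -> K^o).
Local Notation Twords := (seq (gidx (Pi T)) -> K^o).

Let qE j i : q (j, i) = a j (+) v i.
Proof. by rewrite /= /tpar /= addbN. Qed.

(** The components of [m] and, in [dcomp], of the differential of V. *)
Definition comp (i : I) : Iwords := symV (m (svar K v i)).

Lemma comp_homog i : whomog v (~~ v i) (comp i).
Proof. by apply: sym_homog; apply: (der_parity dm); apply: shomog_svar. Qed.

Lemma comp_order i w : (size w < 2)%N -> comp i w = 0.
Proof. exact: sym_order (@m2 i). Qed.

Definition dcomp (i : I) : Iwords :=
  letter (fun l => (-1) ^+ v i * gdual (Pi V) i (dg_d (Pi V) (gbase (Pi V) l))).

Lemma dcomp_homog i : whomog v (~~ v i) (dcomp i).
Proof.
apply: whomog_letter => l ne.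
rewrite (dg_d_odd (@gbase_homog _ (Pi V) l)) ?mulr0 //.
by move: ne; case: (v i) (v l) => -[].
Qed.

Lemma sym_m g : symV (m g) = wfield v comp (symV g).
Proof. by rewrite (derivation_vfield charK0 dm) sym_vfield. Qed.

Lemma sym_d g : symV (dsym g) = wfield v dcomp (symV g).
Proof.
rewrite /dsym sym_vfield; congr (wfield v _ _); apply/funext=> i.
exact: sym_linear_field.
Qed.

Definition wdiv : Iwords := \sum_i wshift i (comp i).

Lemma sym_div : symV (divergence true m) = wdiv.
Proof. exact: sym_divergence. Qed.

Definition tcomp (x : J * I) : Twords := hadA (coord_word (A := A) x.1) (comp x.2).

(** The signs of duality on A (x) V and on V and the Koszul sign of the tensor product
    combine to those of [had] and [alg_word]; the last factor on the left is the sign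
    of the output coordinate, whose parity is that of the word in A. *)
Lemma tensor_sign_had (s : seq (J * I)) :
  word_sign K q s * (-1) ^+ @tensor_sign K A V s * word_sign K v (map snd s)
    * (-1) ^+ wpar a (map fst s)
  = (-1) ^+ hsign a v s * word_sign K a (map fst s).
Proof.
elim: s => [|[j i] s IH]; first by rewrite /word_sign /= !expr0 !mulr1.
rewrite !map_cons !word_sign_cons (wpar_pairs qE) wpar_cons qE.
have -> : @tensor_sign K A V ((j, i) :: s)
  = a j (+) (v i && wpar a (map fst s)) (+) @tensor_sign K A V s by [].
rewrite -[hsign a v _]/((a j && wpar v (map snd s)) (+) hsign a v s) !signr_addb.
set x := word_sign K q s; set y := word_sign _ v _; set z := word_sign _ a _.
rewrite -/x -/y -/z in IH.
transitivity ((-1) ^+ (a j && (wpar v (map snd s) (+) wpar a (map fst s)))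
   * (x * (-1) ^+ @tensor_sign K A V s * y * (-1) ^+ wpar a (map fst s))).
  by case: (a j) (v i) (wpar a _) (wpar v _) => -[] [] [] /=; ring.
by rewrite IH; case: (a j) (wpar a _) (wpar v _) => -[] [] /=; ring.
Qed.

Lemma gdual_tpure j (i : I) z x y :
  gdual (Pi T) (j, i) (z *: tpure x y) = z * (gdual A j x * gdual (Pi V) i y).
Proof. by rewrite linearZ_LR /= /tdual ffunE. Qed.

(** The A (x) V structure is the scalar extension of [m]: its component at (j, i) is
    the e_j-coordinate of the extension of m(x_i).  Words with fewer than two letters
    do not matter, because m(x_i) has order at least 2. *)
Lemma sym_tensor x : symT (mT (svar K q x)) = tcomp x.
Proof.
case: x => j i; rewrite /tensor_Linfty /of_mult vfield_svar //.
pose c : Twords := fun w => (-1) ^+ q (j, i) * word_sign K q w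
  * gdual (Pi T) (j, i) (tensor_mult (mult_of m) w).
have cE : c = tcomp (j, i).
  apply/funext=> s; rewrite /c /tensor_mult /tcomp /had -[(j, i).1]/j -[(j, i).2]/i.
  case: ifP => [_|/negbT]; last first.
    by rewrite -ltnNge => lt; rewrite linear0 comp_order ?size_map // !mulr0.
  rewrite gdual_tpure.
  have -> : gdual (Pi V) i (mult_of m (map snd s))
    = (-1) ^+ v i * word_sign K v (map snd s) * comp i (map snd s).
    rewrite /mult_of linear_sum (bigD1 i) //= linearZ_LR gdual_base eqxx mulr1.
    rewrite big1 ?addr0 // => k ne.
    by rewrite linearZ_LR gdual_base eq_sym (negPf ne) mulr0.
  rewrite /coord_word /alg_word.
  have [e|ne] := eqVneq (wpar a (map fst s)) (a j); last first.
    by rewrite (homog_aprod (s := map fst s)) 1?eq_sym //; ring.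
  rewrite [RHS](_ : _ = ((-1) ^+ hsign a v s * word_sign K a (map fst s))
    * (gdual A j (aprod (map fst s)) * comp i (map snd s))); last by ring.
  rewrite -tensor_sign_had e qE signr_addb.
  by case: (v i); rewrite /=; ring.
have -> : (fun aa : monom q => ((mlen (val aa))`!%:R)^-1 * \sum_(w : (mlen (val aa)).-tuple (gidx (Pi T)))
   c w * sword K q w aa) = @ser K _ q c by apply/funext=> aa; rewrite serE.
rewrite cE sym_ser //; apply: (wsym_had qE); last exact: sym_wsym.
exact: alg_word_sym (@gdual_linear _ A j).
Qed.

(** The scalar extension of the vector field with components [phi i]. *)
Definition tfield (phi : I -> Iwords) (G : Twords) : Twords :=
  wfield q (fun x : J * I => hadA (coord_word (A := A) x.1) (phi x.2)) G.

(** The part of the differential of A (x) V that comes from A. *)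
Definition dA_field : Twords -> Twords :=
  lfield q (fun x y : J * I => (-1) ^+ v x.2
    * ((-1) ^+ a x.1 * gdual A x.1 (dg_d A (gbase A y.1))) * (x.2 == y.2)%:R).

Lemma sym_mT g : symT (mT g) = tfield comp (symT g).
Proof.
rewrite /tensor_Linfty /of_mult sym_vfield; congr (wfield q _ _); apply/funext=> x.
by rewrite -/(tcomp x) -sym_tensor /tensor_Linfty /of_mult vfield_svar.
Qed.

Lemma sym_dT g : symT (dsym g) = dA_field (symT g) + tfield dcomp (symT g).
Proof.
rewrite /dsym sym_vfield /tfield /dA_field /lfield /wfield -big_split.
apply: eq_bigr => -[j i] _ /=; rewrite sym_linear_field.
rewrite -(linD (shuffle_linearl q _)); congr (shuffle q _ _).
apply/funext=> -[|[k l] [|y s]]; rewrite -[RHS]/(letter _ _ + had _ _ _ _ _).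
- by rewrite /had /= /letter /dcomp /= !mulr0 addr0.
- rewrite /had /= /dcomp /= coord_word1 /wpar /= andbF expr0 mul1r.
  rewrite /letter.
  rewrite /tdual (td_tpure _ (@gbase_homog _ A k)) !ffunE /= !gdual_base.
  rewrite /tpar /GRing.scale /=.
  by have [->|_] := eqVneq j k; case: (a _) (gpar V i) => -[] /=; ring.
by rewrite /had /= /dcomp /letter !mulr0 addr0.
Qed.

(** The components have no constant term, so their scalars are products of at least
    one element of A, and these can be expanded in the basis. *)
Lemma tfield_trace (phi : I -> Iwords) (f : Iwords) :
  (forall i, whomog v (~~ v i) (phi i)) -> (forall i, phi i [::] = 0) ->
  whomog v false f ->
  tfield phi (hadA (@trace_word K A) f) = hadA (@trace_word K A) (wfield v phi f).
Proof.
move=> hphi phi0 hf; rewrite /tfield /wfield (lin_sum (had_linearr a v _)).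
rewrite -(pair_bigA _ (fun j i => shuffle q (hadA (coord_word j) (phi i))
  (wshift (j, i) (hadA (@trace_word K A) f)))) /= exchange_big; apply: eq_bigr => i _ /=.
pose mu j := (-1) ^+ (a j && v i) *: wshift j (@trace_word K A).
rewrite -(had_shuffle qE (lam := @coord_word K A) (mu := mu) (hphi i) (whomog_shift (i := i) hf)
  (alg_word_sym (@mul_trace_linear _ A))).
  apply: eq_bigr => j _; rewrite (wshift_had a _ _ _ hf).
  by rewrite /mu (linZ (had_linearl _ _ _)).
move=> s s' w sw; case: s sw => [|k s] sw.
  by rewrite (size0nil sw) phi0 !mulr0.
congr (_ * _); rewrite -/(@trace_word K A); rewrite -trace_word_cat // mulr_sumr; apply: eq_bigr => j _.
have [e|ne] := eqVneq (wpar a (k :: s)) (a j); last by rewrite coord_word_homog //; ring.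
by rewrite e /mu fctE /wshift /GRing.scale /=; ring.
Qed.

(** Up to sign this is the extension of f evaluated by t composed with d. *)
Lemma dA_field_trace f : wsym v f -> whomog v false f ->
  dA_field (hadA (@trace_word K A) f) = 0.
Proof.
move=> sf hf; rewrite /dA_field.
rewrite (lfield_had qE (@dmat_odd _ A) (alg_word_sym (@mul_trace_linear _ A)) sf hf).
by rewrite lfield_trace_word (lin0 (had_linearl a v f)) scaler0.
Qed.

(** The sum over j contracts the output of the product in A with its first factor,
    which gives the trace. *)
Lemma div_tensor : symT (divergence true mT) = hadA (@trace_word K A) wdiv.
Proof.
rewrite sym_divergence /wdiv (lin_sum (had_linearr a v _)).
rewrite (eq_bigr (fun x : J * I => wshift (x.1, x.2) (hadA (coord_word x.1) (comp x.2)))); last first.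
  by case=> j i _; rewrite sym_tensor.
rewrite -(pair_bigA _ (fun j i => wshift (j, i) (hadA (coord_word j) (comp i)))) /=.
rewrite exchange_big; apply: eq_bigr => i _ /=; apply/funext=> s.
rewrite fct_sumE.
under eq_bigr do rewrite (wshift_had a _ _ _ (@comp_homog i)) addNb addbb andbT fctE.
case: s => [|x s]; first rewrite {2}/had /=.
  rewrite big1 => [|j _]; first by rewrite [wshift i _ _]comp_order ?mulr0.
  by rewrite /had /= [wshift i _ _]comp_order ?mulr0 ?scaler0.
rewrite [RHS]/had -trace_word_contract // mulr_suml mulr_sumr.
by apply: eq_bigr => j _; rewrite /had /GRing.scale /wshift /=; ring.
Qed.

Section AtIdempotent.
Variables (u : A) (hu : homog false u) (uu : cdga_mul A u u = u).
Hypothesis du : dg_d A u = 0.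

Local Notation ep := (fun j => gdual A j u).
Local Notation restrictA := (@wrestrict K J I ep).

Lemma restrict_trace (f : Iwords) : f [::] = 0 ->
  restrictA (hadA (@trace_word K A) f) = mul_trace u *: f.
Proof.
move=> f0; apply/funext=> w; rewrite (restrict_had _ (even_coord hu)) fctE.
case: w => [|i w]; first by rewrite f0 mulr0 scaler0.
by rewrite (iter_jshift hu uu) //; apply: mul_trace_linear.
Qed.

Lemma restrict_coord j (f : Iwords) : f [::] = 0 ->
  restrictA (hadA (coord_word (A := A) j) f) = gdual A j u *: f.
Proof.
move=> f0; apply/funext=> w; rewrite (restrict_had _ (even_coord hu)) fctE.
case: w => [|i w]; first by rewrite f0 mulr0 scaler0.
by rewrite (iter_jshift hu uu) //; apply: gdual_linear.
Qed.

(** The components of the extension restrict to u_j [phi i], and the sum over j of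
    u_j d/dx_(j,i) is the derivative along u (x) e_i. *)
Lemma restrict_tfield (phi : I -> Iwords) (G : Twords) : (forall i, phi i [::] = 0) ->
  restrictA (tfield phi G) = wfield v phi (restrictA G).
Proof.
move=> phi0; rewrite /tfield /wfield (lin_sum (@restrict_linear _ _ _ _)).
rewrite (eq_bigr (fun x : J * I => restrictA (shuffle q
  (hadA (coord_word x.1) (phi x.2)) (wshift (x.1, x.2) G)))); last by case.
rewrite -(pair_bigA _ (fun j i => restrictA (shuffle q (hadA (coord_word j) (phi i))
  (wshift (j, i) G)))) /= exchange_big; apply: eq_bigr => i _ /=.
rewrite wshift_restrict /ishift (lin_sum (@restrict_linear _ _ _ _)).
rewrite (lin_sum (shuffle_linearr v _)); apply: eq_bigr => j _.
rewrite (restrict_shuffle qE (even_coord hu)) restrict_coord //.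
rewrite (linZ (@restrict_linear _ _ _ _)).
by rewrite (linZ (shuffle_linearl v _)) (linZ (shuffle_linearr v _)).
Qed.

(** The components restrict to coordinates of du. *)
Lemma restrict_dA_field (G : Twords) : restrictA (dA_field G) = 0.
Proof.
rewrite /dA_field /lfield (lin_sum (@restrict_linear _ _ _ _)) big1 // => -[j i] _.
rewrite (restrict_shuffle qE (even_coord hu)).
set f := letter _; suff -> : restrictA f = 0 by rewrite (lin0 (shuffle_linearl v _)).
apply: wordsP => // l; rewrite wshift_restrict /ishift.
rewrite (_ : \sum_k _ = 0) ?(lin0 (@restrict_linear _ _ _ _)) //.
under eq_bigr do rewrite wshift_letter scalerA /=.
rewrite -scaler_suml (_ : \sum_k _ = 0) ?scale0r //.
transitivity ((-1) ^+ v i * (-1) ^+ a j * (i == l)%:R * gdual A j (dg_d A u)); last first.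
  by rewrite du linear0 mulr0.
rewrite [in RHS](gbase_dual u) linear_sum linear_sum mulr_sumr.
by apply: eq_bigr => k _; rewrite !linearZ_LR /=; ring.
Qed.

End AtIdempotent.

Lemma trace_word0 : cdga_unimodular A -> @trace_word K A = 0.
Proof. by move=> uA; apply/funext=> s; rewrite /trace_word /alg_word /mul_trace uA mulr0. Qed.

Lemma sym_eq0P (I' : finType) (p' : I' -> bool) (f : series K p') :
  f = 0 <-> (symmetrization f = 0 :> (seq I' -> K^o)).
Proof.
split=> [->|]; last exact: sym_eq0.
exact: (lin0 (@sym_linear K I' p')).
Qed.

Let symV0 : symV (0 : Sym V) = 0.
Proof. exact: (lin0 (@sym_linear K I v)). Qed.

Let symT0 : symT (0 : Sym T) = 0.
Proof. exact: (lin0 (@sym_linear K _ q)). Qed.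

Let half_neq0 : 2%:R^-1 != 0 :> K.
Proof. by rewrite invr_eq0 (char0_natS_neq0 charK0). Qed.

Lemma strictly_unimodularP (W : dgspace K) (xi : Sym W -> Sym W) : linear xi ->
  strictly_unimodular xi <-> divergence true xi = 0.
Proof.
move=> lxi; have d0 : dsym (0 : Sym W) = 0 by apply: (lin0 (@vfield_linear K _ _ _)).
rewrite /strictly_unimodular /unimodular_lift (lin0 lxi) d0 add0r addr0.
split=> [[_ _ /eqP]|->]; first by rewrite scaler_eq0 (negPf half_neq0) => /eqP.
by rewrite scaler0.
Qed.

Lemma wdiv_nil : wdiv [::] = 0.
Proof. by rewrite /wdiv fct_sumE big1 // => i _; rewrite /wshift comp_order. Qed.

Lemma mT_linear : linear mT.
Proof. exact: vfield_linear. Qed.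

Lemma strict_tensor :
  strictly_unimodular mT <-> strictly_unimodular m \/ cdga_unimodular A.
Proof.
rewrite (strictly_unimodularP mT_linear) (strictly_unimodularP (der_linear dm)).
rewrite !sym_eq0P div_tensor sym_div; split=> [h|[->|/trace_word0->]]; first last.
- exact: (lin0 (had_linearl a v _)).
- exact: (lin0 (had_linearr a v _)).
have [uA|nuA] := pselect (cdga_unimodular A); [by right|left].
have [u [hu uu _ tu]] := closed_idempotent_exists charK0 nuA.
have /eqP := restrict_trace hu uu wdiv_nil.
rewrite h (lin0 (@restrict_linear _ _ _ _)) eq_sym scaler_eq0 => /orP[/eqP tu0|/eqP//].
by rewrite /mul_trace in tu0; rewrite tu0 eqxx in tu.
Qed.

Lemma lift_tensor :
  has_unimodular_lift mT <-> has_unimodular_lift m \/ cdga_unimodular A.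
Proof.
have dc0 i : dcomp i [::] = 0 by [].
have c0 i : comp i [::] = 0 by apply: comp_order.
split=> [[F [hF oF eF]]|[[f [hf ordf ef]]|uA]]; last first.
- have [_] := strict_tensor; case; first by right.
  by move=> h1 h2 h3; exists 0.
- have hs := sym_homog hf; have ss := sym_wsym f.
  have st : wsym q (hadA (@trace_word K A) (symV f)).
    exact: (wsym_had qE (alg_word_sym (@mul_trace_linear _ A)) ss).
  exists (@ser K _ q (hadA (@trace_word K A) (symV f))); split.
  + apply: (shomog_sym charK0); rewrite sym_ser //.
    exact: (whomog_had qE (@trace_word_homog _ A) hs).
  + move=> b; rewrite ltnS leqn0 => /eqP b0; rewrite /ser b0 /= /had /=.
    by rewrite (sym_order ordf) // !mulr0 scale0r mulr0.
  apply/sym_eq0P; rewrite !(linD (@sym_linear _ _ _)) (linZ (@sym_linear _ _ _)).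
  rewrite sym_dT sym_mT div_tensor sym_ser // dA_field_trace // add0r.
  rewrite !tfield_trace //; [|exact: comp_homog|exact: dcomp_homog].
  rewrite -(linZ (had_linearr _ _ _)) -!(linD (had_linearr _ _ _)).
  rewrite -sym_d -sym_m -sym_div -(linZ (@sym_linear _ _ _)) -!(linD (@sym_linear _ _ _)).
  by rewrite ef symV0 (lin0 (had_linearr _ _ _)).
have [uA|nuA] := pselect (cdga_unimodular A); [by right|left].
have [u [hu uu du tu]] := closed_idempotent_exists charK0 nuA.
set G := wrestrict (fun j => gdual A j u) (symT F).
have hG : whomog v false G by apply: (restrict_homog qE (even_coord hu)); apply: sym_homog.
have sG : wsym v G by apply: (restrict_sym qE (even_coord hu)); apply: sym_wsym.
pose c := (mul_trace u)^-1.
exists (c *: @ser K _ v G); split.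
- apply: (shomog_sym charK0); rewrite (linZ (@sym_linear _ _ _)) sym_ser // => w ne.
  by rewrite fctE (hG w ne) scaler0.
- move=> b; rewrite ltnS leqn0 => /eqP b0; rewrite fctE /ser b0 /=.
  have -> : G [::] = 0 by apply: (sym_order oF).
  by rewrite scale0r mulr0 scaler0.
apply/sym_eq0P; rewrite !(linD (@sym_linear _ _ _)) (linZ (@sym_linear _ _ _)).
rewrite sym_d sym_m sym_div (linZ (@sym_linear _ _ _)) sym_ser //.
rewrite !(linZ (@wfield_linear _ _ _ _)).
have /(congr1 (wrestrict (fun j => gdual A j u))) :
    symT (dsym F + 2%:R^-1 *: divergence true mT + mT F) = 0.
  by rewrite eF symT0.
rewrite !(linD (@sym_linear _ _ _)) (linZ (@sym_linear _ _ _)) sym_dT sym_mT div_tensor.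
rewrite !(linD (@restrict_linear _ _ _ _)) (linZ (@restrict_linear _ _ _ _)).
rewrite (lin0 (@restrict_linear _ _ _ _)) (restrict_dA_field hu du) add0r.
rewrite !(restrict_tfield hu uu) // (restrict_trace hu uu wdiv_nil) -/G => e.
transitivity (c *: (wfield v dcomp G + 2^-1 *: (mul_trace u *: wdiv) + wfield v comp G)).
  rewrite !scalerDr; congr (_ + _ + _); rewrite !scalerA; congr (_ *: _).
  by rewrite mulrAC mulVf ?mul1r.
by rewrite e scaler0.
Qed.

End Tensor.

Theorem theorem7p10 (K : fieldType) (charK0 : [pchar K] =i pred0)
    (A : cdga K) (V : dgspace K) (m : Sym V -> Sym V)
    (m_Linfty : is_Linfty m) :
  (strictly_unimodular (tensor_Linfty A m) <->
     strictly_unimodular m \/ cdga_unimodular A)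
  /\
  (has_unimodular_lift (tensor_Linfty A m) <->
     has_unimodular_lift m \/ cdga_unimodular A).
Proof.
by case: m_Linfty => dm m2 _; split; [apply: strict_tensor|apply: lift_tensor].
Qed.
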